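(* Let $\Omega\subsetneq\mathbb{C}$ be a domain and $z_0\in\partial\Omega$ such that there is $\delta>0$ with $D(z_0,r)\cap\Omega$ connected for every $0<r\le\delta$. Then $U_1(\Omega,z_0)$ is a dense $G_\delta$ subset of $H(\Omega)$.
   Context: $H(\Omega)$ is the space of holomorphic functions on $\Omega$ with the topology of uniform convergence on compact subsets. $D(z_0,r)$ is the open disk of center $z_0$, radius $r$. $U_1(\Omega,z_0)$ is the set of $f\in H(\Omega)$ for which there exist no $r>0$ and no holomorphic $F:D(z_0,r)\to\mathbb{C}$ with $F=f$ on $\Omega\cap D(z_0,r)$. *)

(* Defs.v *)
From Stdlib Require Import Reals List.
Open Scope R_scope.

Definition Cplx : Type := (R * R)%type.

Definition Cadd (z w : Cplx) : Cplx := (fst z + fst w, snd z + snd w).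
Definition Csub (z w : Cplx) : Cplx := (fst z - fst w, snd z - snd w).
Definition Cmul (z w : Cplx) : Cplx :=
  (fst z * fst w - snd z * snd w, fst z * snd w + snd z * fst w).
Definition Cnorm (z : Cplx) : R := sqrt (fst z ^ 2 + snd z ^ 2).

Definition disk (z0 : Cplx) (r : R) : Cplx -> Prop := fun z => Cnorm (Csub z z0) < r.

Definition is_open (U : Cplx -> Prop) : Prop :=
  forall z, U z -> exists r, 0 < r /\ forall w, disk z r w -> U w.

Definition open_connected (S : Cplx -> Prop) : Prop :=
  forall A B : Cplx -> Prop, is_open A -> is_open B ->
    (forall z, S z <-> (A z \/ B z)) ->
    (forall z, ~ (A z /\ B z)) ->
    (forall z, ~ A z) \/ (forall z, ~ B z).

Definition domain (O : Cplx -> Prop) : Prop :=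
  is_open O /\ (exists z, O z) /\ open_connected O.

(* boundary point of an open set (closure minus the set itself) *)
Definition boundary_point (O : Cplx -> Prop) (z0 : Cplx) : Prop :=
  ~ O z0 /\ forall r, 0 < r -> exists z, disk z0 r z /\ O z.

Definition compact (K : Cplx -> Prop) : Prop :=
  forall (I : Type) (U : I -> Cplx -> Prop),
    (forall i, is_open (U i)) ->
    (forall z, K z -> exists i, U i z) ->
    exists l : list I, forall z, K z -> exists i, In i l /\ U i z.

Definition C_differentiable_at (U : Cplx -> Prop) (f : Cplx -> Cplx) (z : Cplx) : Prop :=
  exists l : Cplx, forall eps, 0 < eps -> exists d, 0 < d /\
    forall w, U w -> Cnorm (Csub w z) < d ->
      Cnorm (Csub (Csub (f w) (f z)) (Cmul l (Csub w z))) <= eps * Cnorm (Csub w z).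

Definition holomorphic_on (U : Cplx -> Prop) (f : Cplx -> Cplx) : Prop :=
  forall z, U z -> C_differentiable_at U f z.

(* H(O): elements are functions Cplx -> Cplx holomorphic on O (identified when equal on O).
   A "subset" of H(O) is a predicate on Cplx -> Cplx, considered only on holomorphic functions. *)

Definition H_open (O : Cplx -> Prop) (P : (Cplx -> Cplx) -> Prop) : Prop :=
  forall f, holomorphic_on O f -> P f ->
    exists (K : Cplx -> Prop) (eps : R),
      compact K /\ (forall z, K z -> O z) /\ 0 < eps /\
      forall g, holomorphic_on O g ->
        (forall z, K z -> Cnorm (Csub (g z) (f z)) < eps) -> P g.

Definition H_dense (O : Cplx -> Prop) (S : (Cplx -> Cplx) -> Prop) : Prop :=
  forall P, H_open O P -> (exists f, holomorphic_on O f /\ P f) ->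
    exists g, holomorphic_on O g /\ P g /\ S g.

Definition H_Gdelta (O : Cplx -> Prop) (S : (Cplx -> Cplx) -> Prop) : Prop :=
  exists Pn : nat -> (Cplx -> Cplx) -> Prop,
    (forall n, H_open O (Pn n)) /\
    forall f, holomorphic_on O f -> (S f <-> forall n, Pn n f).

Definition U1 (O : Cplx -> Prop) (z0 : Cplx) (f : Cplx -> Cplx) : Prop :=
  holomorphic_on O f /\
  ~ (exists r (F : Cplx -> Cplx), 0 < r /\ holomorphic_on (disk z0 r) F /\
       forall z, O z -> disk z0 r z -> F z = f z).

(* Main.v *)
(** For [a] in [O] near [z0], the Taylor coefficients of [f] at [a] are averages of [f] over a small
    circle, hence continuous in [f].  If [f] extends to a disk about [z0], then for [a] close enough
    to [z0] the coefficients are [O (rho^-k)] with [rho = 3 |a - z0|]; conversely such a bound makes the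
    Taylor series at [a] converge on a disk containing [D (z0, 2 |a - z0|)], and, the intersection of
    [O] with that disk being connected, the identity theorem shows that its sum extends [f].  Letting
    [a] run through a sequence tending to [z0] and the implied constant through the integers exhibits
    the extendable functions as a countable union of closed sets.  Density: if [f] extends, then
    [f + c / (z - z0)] does not, for any [c <> 0].

    The Taylor expansion of a function that is merely complex differentiable rests on Goursat's
    bisection argument, applied to pullbacks along maps of the unit square into the plane; the maps used
    are homotopies of circles shrinking towards a point. *)

From Stdlib Require Import Reals Lra Lia List Cantor ClassicalEpsilon.
From Coquelicot Require Import Coquelicot.
(* Last, because Reals and Coquelicot also define [compact] and [domain]. *)
Require Import Defs.
Open Scope R_scope.

(** The constants fit together as follows, with [d = |a - z0|]. The identity theorem needs a disk
    about [a] on which the sum and [f] agree, so [a] must lie inside the disk about [z0]: radius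
    [2 d] rather than [d]. That disk lies in [D (a, 3 d)], and [D (a, 3 d)] lies in [D (z0, 4 d)],
    hence inside [D (z0, r)] once [4 d < r]. The radius of the extension is thus not preserved, only
    its existence.

    For continuity in [f] the averaging circle must lie in [O], so its radius [s] is less than [d]
    because [z0] is not in [O]; the bound on the coefficients concerns the radius [3 d]. The two
    scales are linked by the independence of coefficients from the radius, applied to the extension
    and not to [f].

    Without connectedness of the intersection, the sum of the series could agree with [f] near [a]
    and differ from it on another component that also accumulates at [z0].

    The integral of [dw / (w - z)] over a circle is never evaluated directly: its value comes from
    expanding the kernel against the constant function 1, whose coefficients are known. *)

(** * Bisection of the unit square *)

(** If [P 0 0 1] failed, repeated quartering would give nested failing squares shrinking to a point
    [(u, v)], against the local hypothesis there. Besides Goursat's theorem, this yields compactness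
    of [[0, 1]], by predicates that ignore [x]. *)
Lemma square_induction (P : R -> R -> R -> Prop) :
  (forall x y l, 0 < l -> 0 <= x -> x + l <= 1 -> 0 <= y -> y + l <= 1 ->
     P x y (l / 2) -> P (x + l / 2) y (l / 2) ->
     P x (y + l / 2) (l / 2) -> P (x + l / 2) (y + l / 2) (l / 2) -> P x y l) ->
  (forall u v, 0 <= u <= 1 -> 0 <= v <= 1 -> exists d, 0 < d /\
     forall x y l, 0 < l < d -> 0 <= x -> x + l <= 1 -> 0 <= y -> y + l <= 1 ->
       x <= u <= x + l -> y <= v <= y + l -> P x y l) ->
  P 0 0 1.
Proof.
intros Hsplit Hloc.
destruct (excluded_middle_informative (P 0 0 1)) as [H0|H0]; [exact H0|exfalso].
(* Corner of the first quarter, of side [l], on which [P] fails. The fourth quarter is the default: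
   it is chosen only when [P] holds on the other three, and then it must fail by [Hsplit]. *)
pose (next := fun (q : R * R) (l : R) =>
  let (x, y) := q in
  if excluded_middle_informative (P x y l) then
    if excluded_middle_informative (P (x + l) y l) then
      if excluded_middle_informative (P x (y + l) l) then (x + l, y + l)
      else (x, y + l)
    else (x + l, y)
  else (x, y)).
pose (len := fun n => (/ 2) ^ n).
pose (q := nat_rect (fun _ => (R * R)%type) (0, 0) (fun n p => next p (len (S n)))).
assert (Hlen : forall n, len (S n) = len n / 2) by (intro n; unfold len; simpl; lra).
assert (Hpos : forall n, 0 < len n) by (intro n; apply pow_lt; lra).
assert (Hstep : forall n,
  (fst (q n) <= fst (q (S n)) /\ fst (q (S n)) + len (S n) <= fst (q n) + len n) /\
  (snd (q n) <= snd (q (S n)) /\ snd (q (S n)) + len (S n) <= snd (q n) + len n)).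
{ intro n. change (q (S n)) with (next (q n) (len (S n))).
  pose proof (Hpos n). rewrite !Hlen. unfold next. destruct (q n) as [x y].
  repeat destruct excluded_middle_informative; simpl; lra. }
assert (Hinv : forall n, 0 <= fst (q n) /\ fst (q n) + len n <= 1 /\
   0 <= snd (q n) /\ snd (q n) + len n <= 1).
{ induction n as [|n IH]; [simpl; unfold len; simpl; lra|].
  generalize (Hstep n); lra. }
assert (Hbad : forall n, ~ P (fst (q n)) (snd (q n)) (len n)).
{ induction n as [|n IH]; [exact H0|].
  pose proof (Hinv n) as Hi. pose proof (Hpos n) as Hp.
  change (q (S n)) with (next (q n) (len (S n))). rewrite Hlen.
  unfold next. destruct (q n) as [x y]; simpl in *.
  repeat destruct excluded_middle_informative; simpl; trivial.
  intro Hl. apply IH, Hsplit; tauto. }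
(* Nested intervals: [u] is the supremum of the left endpoints. *)
assert (Hlim : forall f : nat -> R,
  (forall n, f n <= f (S n) /\ f (S n) + len (S n) <= f n + len n) ->
  exists u, forall n, f n <= u <= f n + len n).
{ intros f Hf.
  assert (Hm : forall n k, f n <= f (n + k)%nat /\ f (n + k)%nat + len (n + k)%nat <= f n + len n).
  { intros n k; induction k as [|k IH]; [rewrite Nat.add_0_r; lra|].
    rewrite Nat.add_succ_r. generalize (Hf (n + k)%nat); lra. }
  destruct (completeness (fun x => exists n, x = f n)) as [u [Hu1 Hu2]].
  - exists (f 0%nat + len 0%nat). intros x [n ->].
    generalize (Hm 0%nat n) (Hpos (0+n)%nat); simpl; lra.
  - exists (f 0%nat), 0%nat; reflexivity.
  - exists u; intro n; split; [apply Hu1; exists n; reflexivity|].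
    apply Hu2. intros x [m ->].
    destruct (Nat.le_ge_cases n m) as [Hnm|Hnm].
    + replace m with (n + (m - n))%nat by lia.
      generalize (Hm n (m - n)%nat) (Hpos (n + (m - n))%nat); lra.
    + replace n with (m + (n - m))%nat by lia.
      generalize (Hm m (n - m)%nat) (Hpos (m + (n - m))%nat); lra. }
destruct (Hlim (fun n => fst (q n))) as [u Hu]; [intro n; apply Hstep|].
destruct (Hlim (fun n => snd (q n))) as [v Hv]; [intro n; apply Hstep|].
destruct (Hloc u v) as [d [Hd Hd']].
- pose proof (Hu 0%nat); pose proof (Hinv 0%nat); lra.
- pose proof (Hv 0%nat); pose proof (Hinv 0%nat); lra.
- destruct (pow_lt_1_zero (/ 2)) with (y := d) as [N HN]; [rewrite Rabs_pos_eq; lra|exact Hd|].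
  apply (Hbad N). destruct (Hinv N) as [? [? [? ?]]]. apply Hd'; auto.
  split; [apply Hpos|]. specialize (HN N (le_n N)).
  rewrite Rabs_pos_eq in HN; [exact HN|apply Rlt_le, Hpos].
Qed.

(** * Integrals of complex-valued functions of a real variable *)

Definition ccont (F : R -> C) (x : R) : Prop :=
  continuous (fun t => fst (F t)) x /\ continuous (fun t => snd (F t)) x.

Definition cderiv (F : R -> C) (x : R) (l : C) : Prop :=
  is_derive (fun t => fst (F t)) x (fst l) /\ is_derive (fun t => snd (F t)) x (snd l).

Definition cint (F : R -> C) (a b : R) : C :=
  (RInt (fun t => fst (F t)) a b, RInt (fun t => snd (F t)) a b).

Lemma cderiv_ccont F x l : cderiv F x l -> ccont F x.
Proof.
intros [H1 H2]; split; apply (ex_derive_continuous (K := R_AbsRing) (V := R_NormedModule)); eexists; eassumption.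
Qed.

Lemma ccont_const c x : ccont (fun _ => c) x.
Proof. split; apply continuous_const. Qed.

Lemma ccont_plus F G x : ccont F x -> ccont G x -> ccont (fun t => F t + G t)%C x.
Proof.
intros [F1 F2] [G1 G2]; split; simpl.
- apply (continuous_plus _ _ x F1 G1).
- apply (continuous_plus _ _ x F2 G2).
Qed.

Lemma ccont_mult F G x : ccont F x -> ccont G x -> ccont (fun t => F t * G t)%C x.
Proof.
intros [F1 F2] [G1 G2]; split; simpl.
- apply (continuous_minus (fun t => fst (F t) * fst (G t)) (fun t => snd (F t) * snd (G t)));
  apply (continuous_mult (K := R_AbsRing)); assumption.
- apply (continuous_plus (fun t => fst (F t) * snd (G t)) (fun t => snd (F t) * fst (G t)));
  apply (continuous_mult (K := R_AbsRing)); assumption.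
Qed.

Lemma ccont_minus F G x : ccont F x -> ccont G x -> ccont (fun t => F t - G t)%C x.
Proof.
intros [F1 F2] [G1 G2]; split; simpl.
- apply (continuous_minus _ _ x F1 G1).
- apply (continuous_minus _ _ x F2 G2).
Qed.

Lemma Cmod_le_abs (z : C) : Cmod z <= Rabs (fst z) + Rabs (snd z).
Proof.
replace z with ((fst z, 0) + Ci * (snd z, 0))%C at 1
  by (destruct z; unfold Cplus, Cmult, Ci; simpl; f_equal; ring).
eapply Rle_trans; [apply Cmod_triangle|].
rewrite Cmod_mult, Cmod_Ci, Rmult_1_l.
change (fst z, 0) with (RtoC (fst z)); change (snd z, 0) with (RtoC (snd z)).
rewrite !Cmod_R; lra.
Qed.

Lemma Cminus_eq_0 (z w : C) : (z - w)%C = 0%C -> z = w.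
Proof. intro H. replace z with (z - w + w)%C by ring. rewrite H; ring. Qed.

Lemma abs_fst_le (z : C) : Rabs (fst z) <= Cmod z.
Proof. apply (Rle_trans _ _ _ (Rmax_l _ _) (Rmax_Cmod z)). Qed.

Lemma abs_snd_le (z : C) : Rabs (snd z) <= Cmod z.
Proof. apply (Rle_trans _ _ _ (Rmax_r _ _) (Rmax_Cmod z)). Qed.

Lemma continuous_eps (f : R -> R) x :
  continuous f x <->
  forall eps, 0 < eps -> exists d, 0 < d /\ forall y, Rabs (y - x) < d -> Rabs (f y - f x) < eps.
Proof.
split.
- intros H eps He.
  destruct (proj1 (filterlim_locally f (f x)) H (mkposreal eps He)) as [d Hd].
  exists d; split; [apply cond_pos|]. intros y Hy; apply (Hd y Hy).
- intro H. apply filterlim_locally. intro eps.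
  destruct (H eps (cond_pos eps)) as [d [Hd Hd']].
  exists (mkposreal d Hd). intros y Hy; apply (Hd' y Hy).
Qed.

Lemma ccont_eps F x :
  ccont F x <->
  forall eps, 0 < eps -> exists d, 0 < d /\ forall y, Rabs (y - x) < d -> Cmod (F y - F x) < eps.
Proof.
split.
- intros [H1 H2] eps He.
  destruct (proj1 (continuous_eps _ _) H1 (eps / 2)) as [d1 [? Hd1]]; [lra|].
  destruct (proj1 (continuous_eps _ _) H2 (eps / 2)) as [d2 [? Hd2]]; [lra|].
  exists (Rmin d1 d2); split; [apply Rmin_glb_lt; assumption|].
  intros y Hy. pose proof (Rmin_l d1 d2); pose proof (Rmin_r d1 d2).
  eapply Rle_lt_trans; [apply Cmod_le_abs|].
  assert (Rabs (fst (F y) - fst (F x)) < eps / 2) by (apply Hd1; lra).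
  assert (Rabs (snd (F y) - snd (F x)) < eps / 2) by (apply Hd2; lra).
  change (fst (F y - F x)%C) with (fst (F y) - fst (F x)).
  change (snd (F y - F x)%C) with (snd (F y) - snd (F x)). lra.
- intro H; split; apply continuous_eps; intros eps He;
  destruct (H eps He) as [d [Hd Hd']]; exists d; split; auto; intros y Hy;
  (eapply Rle_lt_trans; [|apply (Hd' y Hy)]).
  + apply (abs_fst_le (F y - F x)%C).
  + apply (abs_snd_le (F y - F x)%C).
Qed.

Lemma ccont_inv F x : ccont F x -> F x <> 0%C -> ccont (fun t => / F t)%C x.
Proof.
intros H H0. apply ccont_eps; intros eps He.
assert (Hm : 0 < Cmod (F x)) by (apply Cmod_gt_0, H0).
set (m := Cmod (F x)) in *.
destruct (proj1 (ccont_eps F x) H (Rmin (m / 2) (eps * (m * (m / 2))))) as [d [Hd Hd']].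
{ apply Rmin_glb_lt; [lra|]. repeat apply Rmult_lt_0_compat; lra. }
exists d; split; [exact Hd|]; intros y Hy. specialize (Hd' y Hy).
pose proof (Rmin_l (m / 2) (eps * (m * (m / 2)))).
pose proof (Rmin_r (m / 2) (eps * (m * (m / 2)))).
assert (Hy2 : m / 2 < Cmod (F y)).
{ assert (Cmod (F x) <= Cmod (F y) + Cmod (F y - F x)).
  { replace (F x) with (F y + - (F y - F x))%C at 1 by ring.
    eapply Rle_trans; [apply Cmod_triangle|]. rewrite Cmod_opp; lra. }
  unfold m in *; lra. }
assert (Hy0 : F y <> 0%C) by (apply Cmod_gt_0; lra).
replace (/ F y - / F x)%C with (- (F y - F x) / (F y * F x))%C by (field; split; assumption).
rewrite Cmod_div by (apply Cmult_neq_0; assumption).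
rewrite Cmod_opp, Cmod_mult. fold m.
assert (0 < Cmod (F y) * m) by (apply Rmult_lt_0_compat; lra).
apply Rlt_div_l; [assumption|].
eapply Rlt_le_trans; [exact Hd'|].
eapply Rle_trans; [eassumption|].
apply Rmult_le_compat_l; [lra|]. nra.
Qed.

Lemma ccont_pow F x n : ccont F x -> ccont (fun t => F t ^ n)%C x.
Proof.
intro H; induction n as [|n IH]; simpl; [apply ccont_const|apply ccont_mult; assumption].
Qed.

Section CInt.
Variables (a b : R).
Hypothesis Hab : a <= b.

Let on (F : R -> C) := forall x, a <= x <= b -> ccont F x.

Lemma ccont_ex_RInt F : (forall x, a <= x <= b -> ccont F x) ->
  ex_RInt (fun t => fst (F t)) a b /\ ex_RInt (fun t => snd (F t)) a b.
Proof.
intro H; split; apply (@ex_RInt_continuous R_CompleteNormedModule); intros z Hz;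
rewrite Rmin_left, Rmax_right in Hz by lra; apply H; lra.
Qed.

Lemma cint_minus F G : on F -> on G ->
  cint (fun t => F t - G t)%C a b = (cint F a b - cint G a b)%C.
Proof.
intros HF HG. destruct (ccont_ex_RInt F HF), (ccont_ex_RInt G HG).
unfold cint, Cminus, Cplus, Copp; simpl. f_equal; apply (RInt_minus (V := R_CompleteNormedModule)); assumption.
Qed.

Lemma cint_plus F G : on F -> on G ->
  cint (fun t => F t + G t)%C a b = (cint F a b + cint G a b)%C.
Proof.
intros HF HG. destruct (ccont_ex_RInt F HF), (ccont_ex_RInt G HG).
unfold cint, Cplus; simpl. f_equal; apply (RInt_plus (V := R_CompleteNormedModule)); assumption.
Qed.

Lemma cint_scal c F : on F -> cint (fun t => c * F t)%C a b = (c * cint F a b)%C.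
Proof.
intros HF. destruct (ccont_ex_RInt F HF) as [H1 H2].
assert (E : forall k f, ex_RInt f a b -> k * RInt f a b = RInt (fun t => k * f t) a b)
  by (intros; symmetry; apply (RInt_scal (V := R_CompleteNormedModule)); assumption).
unfold cint, Cmult; simpl. f_equal.
- rewrite !E by assumption.
  apply (RInt_minus (fun t => fst c * fst (F t)) (fun t => snd c * snd (F t)));
  apply (ex_RInt_scal (V := R_NormedModule)); assumption.
- rewrite !E by assumption.
  apply (RInt_plus (fun t => fst c * snd (F t)) (fun t => snd c * fst (F t)));
  apply (ex_RInt_scal (V := R_NormedModule)); assumption.
Qed.

Lemma cint_ext F G : (forall x, a <= x <= b -> F x = G x) -> cint F a b = cint G a b.
Proof.
intro H; unfold cint; f_equal; apply RInt_ext; intros x Hx;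
rewrite Rmin_left, Rmax_right in Hx by lra; rewrite H by lra; reflexivity.
Qed.

(** The factor 2 comes from bounding real and imaginary parts separately. It recurs in all later
    estimates, where only the order of magnitude matters. *)
Lemma cint_bound F M : on F -> (forall x, a <= x <= b -> Cmod (F x) <= M) ->
  Cmod (cint F a b) <= 2 * (b - a) * M.
Proof.
intros HF HM. destruct (ccont_ex_RInt F HF) as [H1 H2].
eapply Rle_trans; [apply Cmod_le_abs|]. unfold cint; simpl.
assert (Rabs (RInt (fun t => fst (F t)) a b) <= (b - a) * M).
{ apply abs_RInt_le_const; trivial. intros t Ht.
  eapply Rle_trans; [apply abs_fst_le|apply HM, Ht]. }
assert (Rabs (RInt (fun t => snd (F t)) a b) <= (b - a) * M).
{ apply abs_RInt_le_const; trivial. intros t Ht.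
  eapply Rle_trans; [apply abs_snd_le|apply HM, Ht]. }
lra.
Qed.

Lemma cint_deriv F F' : (forall x, a <= x <= b -> cderiv F x (F' x)) ->
  (forall x, a <= x <= b -> ccont F' x) -> cint F' a b = (F b - F a)%C.
Proof.
intros HF HF'. unfold cint, Cminus, Cplus, Copp; simpl; f_equal;
apply is_RInt_unique;
[apply (is_RInt_derive (fun t => fst (F t)))|apply (is_RInt_derive (fun t => snd (F t)))];
intros x Hx; rewrite Rmin_left, Rmax_right in Hx by lra;
solve [apply HF, Hx | apply HF', Hx].
Qed.

Lemma cint_chasles F c : a <= c <= b -> on F -> cint F a b = (cint F a c + cint F c b)%C.
Proof.
intros Hc HF. destruct (ccont_ex_RInt F HF) as [H1 H2].
unfold cint, Cplus; simpl. f_equal; symmetry; apply (RInt_Chasles (V := R_CompleteNormedModule));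
solve [eapply ex_RInt_Chasles_1; eassumption | eapply ex_RInt_Chasles_2; eassumption].
Qed.
End CInt.

Lemma cderiv_const c x : cderiv (fun _ => c) x 0%C.
Proof. split; apply (is_derive_const (K := R_AbsRing) (V := R_NormedModule)). Qed.

Lemma cderiv_minus F G x f g : cderiv F x f -> cderiv G x g ->
  cderiv (fun t => F t - G t)%C x (f - g)%C.
Proof.
intros [F1 F2] [G1 G2]; split; simpl.
- apply (is_derive_minus _ _ x _ _ F1 G1).
- apply (is_derive_minus _ _ x _ _ F2 G2).
Qed.

Lemma cderiv_plus F G x f g : cderiv F x f -> cderiv G x g ->
  cderiv (fun t => F t + G t)%C x (f + g)%C.
Proof.
intros [F1 F2] [G1 G2]; split; simpl.
- apply (is_derive_plus _ _ x _ _ F1 G1).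
- apply (is_derive_plus _ _ x _ _ F2 G2).
Qed.

Lemma cderiv_mult F G x f g : cderiv F x f -> cderiv G x g ->
  cderiv (fun t => F t * G t)%C x (f * G x + F x * g)%C.
Proof.
intros [F1 F2] [G1 G2]; split; simpl.
- evar_last.
  + apply (is_derive_minus _ _ x _ _ (is_derive_mult _ _ x _ _ F1 G1 Rmult_comm)
      (is_derive_mult _ _ x _ _ F2 G2 Rmult_comm)).
  + unfold minus, plus, opp, mult; simpl; ring.
- evar_last.
  + apply (is_derive_plus _ _ x _ _ (is_derive_mult _ _ x _ _ F1 G2 Rmult_comm)
      (is_derive_mult _ _ x _ _ F2 G1 Rmult_comm)).
  + unfold plus, mult; simpl; ring.
Qed.

(** * Goursat's theorem *)

(** Differentiability with [w] ranging over a full neighbourhood, so that no domain has to be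
    carried along; on open sets it is interchangeable with [holomorphic_on]. *)
Definition cdiff (f : C -> C) (z : C) : Prop :=
  exists l : C, forall eps, 0 < eps -> exists d, 0 < d /\
    forall w, Cmod (w - z) < d -> Cmod (f w - f z - l * (w - z)) <= eps * Cmod (w - z).

Lemma cdiff_continuous f z : cdiff f z ->
  forall eps, 0 < eps -> exists d, 0 < d /\ forall w, Cmod (w - z) < d -> Cmod (f w - f z) < eps.
Proof.
intros [l Hl] eps He. destruct (Hl 1 Rlt_0_1) as [d [Hd Hd']].
assert (Hm := Cmod_ge_0 l).
assert (0 < eps / (1 + Cmod l)) by (apply Rdiv_lt_0_compat; lra).
exists (Rmin d (eps / (1 + Cmod l))); split; [apply Rmin_glb_lt; assumption|].
intros w Hw.
assert (Hw1 := Rlt_le_trans _ _ _ Hw (Rmin_l _ _)).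
assert (Hw2 := Rlt_le_trans _ _ _ Hw (Rmin_r _ _)).
specialize (Hd' w Hw1). apply Rlt_div_r in Hw2; [|lra].
replace (f w - f z)%C with ((f w - f z - l * (w - z)) + l * (w - z))%C by ring.
eapply Rle_lt_trans; [apply Cmod_triangle|]. rewrite Cmod_mult. lra.
Qed.

Lemma ccont_comp f F x : ccont F x -> cdiff f (F x) -> ccont (fun t => f (F t)) x.
Proof.
intros HF Hf. apply ccont_eps; intros eps He.
destruct (cdiff_continuous _ _ Hf eps He) as [d [Hd Hd']].
destruct (proj1 (ccont_eps F x) HF d Hd) as [d2 [Hd2 Hd2']].
exists d2; auto.
Qed.

(* An affine integrand has the primitive [c0 w + c (w - z0)^2], so only its distance to [f] contributes. *)
Lemma path_integral_near_affine (f : C -> C) (F F' : R -> C) (a b M : R) (c0 c z0 : C) :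
  a <= b ->
  (forall x, a <= x <= b -> cderiv F x (F' x)) ->
  (forall x, a <= x <= b -> ccont F' x) ->
  (forall x, a <= x <= b -> cdiff f (F x)) ->
  (forall x, a <= x <= b ->
     Cmod ((f (F x) - (c0 + (c + c) * (F x - z0))) * F' x) <= M) ->
  Cmod (cint (fun t => f (F t) * F' t)%C a b -
        ((c0 * F b + c * ((F b - z0) * (F b - z0))) -
         (c0 * F a + c * ((F a - z0) * (F a - z0)))))%C <= 2 * (b - a) * M.
Proof.
intros Hab HF HF' Hf HM.
assert (HcF : forall x, a <= x <= b -> ccont F x)
  by (intros x Hx; eapply cderiv_ccont, HF, Hx).
assert (HA : forall x, a <= x <= b ->
  ccont (fun t => (c0 + (c + c) * (F t - z0)) * F' t)%C x).
{ intros x Hx. apply ccont_mult; [|auto]. apply ccont_plus; [apply ccont_const|].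
  apply ccont_mult; [apply ccont_const|]. apply ccont_minus; [auto|apply ccont_const]. }
assert (HfF : forall x, a <= x <= b -> ccont (fun t => f (F t) * F' t)%C x).
{ intros x Hx. apply ccont_mult; auto. apply ccont_comp; auto. }
assert (E : cint (fun t => (c0 + (c + c) * (F t - z0)) * F' t)%C a b =
  ((c0 * F b + c * ((F b - z0) * (F b - z0))) -
         (c0 * F a + c * ((F a - z0) * (F a - z0))))%C).
{ apply (cint_deriv a b Hab (fun t => c0 * F t + c * ((F t - z0) * (F t - z0)))%C); [|exact HA].
  intros x Hx. specialize (HF x Hx).
  assert (D0 := cderiv_minus F (fun _ => z0) x _ _ HF (cderiv_const z0 x)).
  assert (D1 := cderiv_mult (fun _ => c) _ x _ _ (cderiv_const c x)
    (cderiv_mult _ _ x _ _ D0 D0)).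
  assert (D := cderiv_plus _ _ x _ _ (cderiv_mult (fun _ => c0) F x _ _ (cderiv_const c0 x) HF) D1).
  cbv beta in D.
  match type of D with cderiv _ _ ?l =>
    replace ((c0 + (c + c) * (F x - z0)) * F' x)%C with l by ring end.
  exact D. }
rewrite <- E, <- cint_minus by auto.
apply cint_bound; trivial.
- intros x Hx; apply ccont_minus; auto.
- intros x Hx. specialize (HM x Hx).
  replace (f (F x) * F' x - (c0 + (c + c) * (F x - z0)) * F' x)%C
    with ((f (F x) - (c0 + (c + c) * (F x - z0))) * F' x)%C by ring. exact HM.
Qed.

Section Goursat.
Variables (f : C -> C) (Z Z1 Z2 : R -> R -> C) (L : R).
Hypothesis HZ1 : forall x y, cderiv (fun t => Z t y) x (Z1 x y).
Hypothesis HZ2 : forall x y, cderiv (fun t => Z x t) y (Z2 x y).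
Hypothesis HC1 : forall x y, ccont (fun t => Z1 t y) x.
Hypothesis HC2 : forall x y, ccont (fun t => Z2 x t) y.
Hypothesis HL : forall x y, 0 <= x <= 1 -> 0 <= y <= 1 ->
  Cmod (Z1 x y) <= L /\ Cmod (Z2 x y) <= L.
Hypothesis Hf : forall x y, 0 <= x <= 1 -> 0 <= y <= 1 -> cdiff f (Z x y).

(** The integral of [f dz] along the image under [Z] of the boundary of the square,
    counterclockwise: bottom, right, top, left. Working with the pullback lets the image degenerate
    or overlap itself. *)
Definition square_boundary_integral (x y l : R) : C :=
  (cint (fun t => f (Z t y) * Z1 t y) x (x + l) +
   cint (fun t => f (Z (x + l)%R t) * Z2 (x + l)%R t) y (y + l) -
   cint (fun t => f (Z t (y + l)%R) * Z1 t (y + l)%R) x (x + l) -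
   cint (fun t => f (Z x t) * Z2 x t) y (y + l))%C.

Let cont1 x y : 0 <= x <= 1 -> 0 <= y <= 1 -> ccont (fun t => f (Z t y) * Z1 t y)%C x.
Proof.
intros; apply ccont_mult; [|apply HC1].
apply (ccont_comp f (fun t => Z t y)); [eapply cderiv_ccont, HZ1|apply Hf; assumption].
Qed.

Let cont2 x y : 0 <= x <= 1 -> 0 <= y <= 1 -> ccont (fun t => f (Z x t) * Z2 x t)%C y.
Proof.
intros; apply ccont_mult; [|apply HC2].
apply (ccont_comp f (fun t => Z x t)); [eapply cderiv_ccont, HZ2|apply Hf; assumption].
Qed.

(** Each inner edge is run through twice, in opposite directions. *)
Lemma square_boundary_integral_split x y l :
  0 < l -> 0 <= x -> x + l <= 1 -> 0 <= y -> y + l <= 1 ->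
  square_boundary_integral x y l =
  (square_boundary_integral x y (l / 2) + square_boundary_integral (x + l / 2) y (l / 2) +
   square_boundary_integral x (y + l / 2) (l / 2) +
   square_boundary_integral (x + l / 2) (y + l / 2) (l / 2))%C.
Proof.
intros. unfold square_boundary_integral.
replace (x + l / 2 + l / 2) with (x + l) by lra.
replace (y + l / 2 + l / 2) with (y + l) by lra.
rewrite (cint_chasles x (x + l)) with (c := x + l / 2) (F := fun t => (f (Z t y) * Z1 t y)%C);
  [|lra|lra|intros; apply cont1; lra].
rewrite (cint_chasles x (x + l)) with (c := x + l / 2)
  (F := fun t => (f (Z t (y + l)%R) * Z1 t (y + l)%R)%C);
  [|lra|lra|intros; apply cont1; lra].
rewrite (cint_chasles y (y + l)) with (c := y + l / 2) (F := fun t => (f (Z x t) * Z2 x t)%C);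
  [|lra|lra|intros; apply cont2; lra].
rewrite (cint_chasles y (y + l)) with (c := y + l / 2)
  (F := fun t => (f (Z (x + l)%R t) * Z2 (x + l)%R t)%C);
  [|lra|lra|intros; apply cont2; lra].
ring.
Qed.

(** Integrate the partial derivatives along two segments parallel to the axes. *)
Let lip u v x y : 0 <= u <= 1 -> 0 <= v <= 1 -> 0 <= x <= 1 -> 0 <= y <= 1 ->
  Cmod (Z x y - Z u v) <= 2 * L * (Rabs (x - u) + Rabs (y - v)).
Proof.
assert (A : forall F F' : R -> C, (forall t, cderiv F t (F' t)) -> (forall t, ccont F' t) ->
  (forall t, 0 <= t <= 1 -> Cmod (F' t) <= L) ->
  forall a b, 0 <= a <= 1 -> 0 <= b <= 1 -> Cmod (F b - F a) <= 2 * L * Rabs (b - a)).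
{ intros F F' HF HF' HB.
  assert (A' : forall a b, 0 <= a <= 1 -> 0 <= b <= 1 -> a <= b ->
     Cmod (F b - F a) <= 2 * L * (b - a)).
  { intros a b Ha Hb Hab. rewrite <- (cint_deriv a b Hab F F') by auto.
    eapply Rle_trans; [apply (cint_bound a b Hab F' L)|]; auto; [|lra].
    intros; apply HB; lra. }
  intros a b Ha Hb. destruct (Rle_dec a b) as [Hab|Hab].
  - rewrite Rabs_pos_eq by lra; auto.
  - rewrite Rabs_left by lra. replace (F b - F a)%C with (- (F a - F b))%C by ring.
    rewrite Cmod_opp. replace (- (b - a)) with (a - b) by ring. apply A'; trivial; lra. }
intros Hu Hv Hx Hy.
replace (Z x y - Z u v)%C with ((Z x y - Z u y) + (Z u y - Z u v))%C by ring.
eapply Rle_trans; [apply Cmod_triangle|].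
assert (H1 := A _ _ (fun t => HZ1 t y) (fun t => HC1 t y) (fun t Ht => proj1 (HL t y Ht Hy)) u x Hu Hx).
assert (H2 := A _ _ (fun t => HZ2 u t) (fun t => HC2 u t) (fun t Ht => proj2 (HL u t Hu Ht)) v y Hv Hy).
simpl in H1, H2. lra.
Qed.

(** An affine function integrates to 0 along the closed contour. What is left of [f] near [Z u v] is
    small compared with the distance to [Z u v]; that distance and the length of the contour are
    both of order [l]. *)
Lemma square_boundary_integral_local eps u v :
  0 < eps -> 0 <= u <= 1 -> 0 <= v <= 1 -> exists d, 0 < d /\
  forall x y l, 0 < l < d -> 0 <= x -> x + l <= 1 -> 0 <= y -> y + l <= 1 ->
    x <= u <= x + l -> y <= v <= y + l ->
    Cmod (square_boundary_integral x y l) <= eps * (l * l).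
Proof.
intros He Hu Hv.
assert (L0 : 0 <= L) by (generalize (proj1 (HL u v Hu Hv)) (Cmod_ge_0 (Z1 u v)); lra).
(* Each side contributes at most [2 * l * (e' * (4 * L * l) * L)], so the four sides give
   [32 * L^2 * e' * l^2]. The [+ 1] covers [L = 0]. *)
set (e' := eps / (32 * (L * L) + 1)).
assert (He' : 0 < e') by (apply Rdiv_lt_0_compat; nra).
destruct (Hf u v Hu Hv) as [k Hk]. destruct (Hk e' He') as [d [Hd Hd']].
exists (d / (4 * L + 1)); split; [apply Rdiv_lt_0_compat; lra|].
intros x y l [Hl Hld] Hx Hxl Hy Hyl Hxu Hyv.
apply Rlt_div_r in Hld; [|lra].
set (z0 := Z u v) in *.
assert (Hdist : forall x' y', x <= x' <= x + l -> y <= y' <= y + l ->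
  Cmod (Z x' y' - z0) <= 4 * L * l).
{ intros x' y' Hx' Hy'. eapply Rle_trans; [apply lip; lra|].
  assert (Rabs (x' - u) <= l) by (apply Rabs_le; lra).
  assert (Rabs (y' - v) <= l) by (apply Rabs_le; lra). nra. }
(* [path_integral_near_affine] has slope [c + c], to be matched with the derivative [k]. *)
set (c := (k / 2)%C).
assert (Hk2 : (c + c)%C = k) by (unfold c; field).
assert (Hrem : forall x' y' w, x <= x' <= x + l -> y <= y' <= y + l -> Cmod w <= L ->
  Cmod ((f (Z x' y') - (f z0 + (c + c) * (Z x' y' - z0))) * w) <= e' * (4 * L * l) * L).
{ intros x' y' w Hx' Hy' Hw. rewrite Hk2, Cmod_mult.
  specialize (Hdist x' y' Hx' Hy').
  apply Rmult_le_compat; try apply Cmod_ge_0; trivial.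
  replace (f (Z x' y') - (f z0 + k * (Z x' y' - z0)))%C
    with (f (Z x' y') - f z0 - k * (Z x' y' - z0))%C by ring.
  eapply Rle_trans; [apply Hd'; lra|]. apply Rmult_le_compat_l; lra. }
assert (S1 := path_integral_near_affine f (fun t => Z t y) (fun t => Z1 t y)
  x (x + l) (e' * (4 * L * l) * L) (f z0) c z0 ltac:(lra) (fun t _ => HZ1 t y) (fun t _ => HC1 t y)
  (fun t Ht => Hf t y ltac:(lra) ltac:(lra))
  (fun t Ht => Hrem t y _ Ht ltac:(lra) (proj1 (HL t y ltac:(lra) ltac:(lra))))).
assert (S2 := path_integral_near_affine f (fun t => Z t (y + l)) (fun t => Z1 t (y + l))
  x (x + l) (e' * (4 * L * l) * L) (f z0) c z0 ltac:(lra) (fun t _ => HZ1 t _) (fun t _ => HC1 t _)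
  (fun t Ht => Hf t (y + l) ltac:(lra) ltac:(lra))
  (fun t Ht => Hrem t (y + l) _ Ht ltac:(lra) (proj1 (HL t (y + l) ltac:(lra) ltac:(lra))))).
assert (S3 := path_integral_near_affine f (fun t => Z x t) (fun t => Z2 x t)
  y (y + l) (e' * (4 * L * l) * L) (f z0) c z0 ltac:(lra) (fun t _ => HZ2 _ t) (fun t _ => HC2 _ t)
  (fun t Ht => Hf x t ltac:(lra) ltac:(lra))
  (fun t Ht => Hrem x t _ ltac:(lra) Ht (proj2 (HL x t ltac:(lra) ltac:(lra))))).
assert (S4 := path_integral_near_affine f (fun t => Z (x + l) t) (fun t => Z2 (x + l) t)
  y (y + l) (e' * (4 * L * l) * L) (f z0) c z0 ltac:(lra) (fun t _ => HZ2 _ t) (fun t _ => HC2 _ t)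
  (fun t Ht => Hf (x + l) t ltac:(lra) ltac:(lra))
  (fun t Ht => Hrem (x + l) t _ ltac:(lra) Ht (proj2 (HL (x + l) t ltac:(lra) ltac:(lra))))).
cbv beta in S1, S2, S3, S4. unfold square_boundary_integral.
match type of S1 with Cmod (?i - ?p)%C <= _ => set (i1 := i) in *; set (p1 := p) in * end.
match type of S2 with Cmod (?i - ?p)%C <= _ => set (i2 := i) in *; set (p2 := p) in * end.
match type of S3 with Cmod (?i - ?p)%C <= _ => set (i3 := i) in *; set (p3 := p) in * end.
match type of S4 with Cmod (?i - ?p)%C <= _ => set (i4 := i) in *; set (p4 := p) in * end.
(* The values of the primitive at the four corners cancel: [p1 + p4 - p2 - p3 = 0]. *)
replace (i1 + i4 - i2 - i3)%C with ((i1 - p1) + (i4 - p4) + (- (i2 - p2)) + (- (i3 - p3)))%C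
  by (unfold p1, p2, p3, p4; ring).
eapply Rle_trans; [apply Cmod_triangle|].
eapply Rle_trans; [apply Rplus_le_compat_r, Cmod_triangle|].
eapply Rle_trans; [apply Rplus_le_compat_r, Rplus_le_compat_r, Cmod_triangle|].
rewrite !Cmod_opp.
replace (x + l - x) with l in * by ring. replace (y + l - y) with l in * by ring.
apply Rle_trans with (32 * (L * L) * e' * (l * l)); [lra|].
apply Rmult_le_compat_r; [nra|].
apply Rle_trans with ((32 * (L * L) + 1) * e'); [nra|].
unfold e'. right; field. nra.
Qed.

Lemma goursat : square_boundary_integral 0 0 1 = 0%C.
Proof.
apply Cmod_eq_0, Rle_antisym; [|apply Cmod_ge_0].
apply le_epsilon; intros eps He. rewrite Rplus_0_l.
replace eps with (eps * (1 * 1)) by ring.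
(* The bound is proportional to the area, hence adds up exactly over the four quarters. *)
apply (square_induction (fun x y l => Cmod (square_boundary_integral x y l) <= eps * (l * l))).
- intros x y l Hl Hx Hxl Hy Hyl H1 H2 H3 H4.
  rewrite square_boundary_integral_split by assumption.
  eapply Rle_trans; [apply Cmod_triangle|].
  eapply Rle_trans; [apply Rplus_le_compat_r, Cmod_triangle|].
  eapply Rle_trans; [apply Rplus_le_compat_r, Rplus_le_compat_r, Cmod_triangle|].
  lra.
- intros u v Hu Hv. apply square_boundary_integral_local; assumption.
Qed.
End Goursat.

(** * Cauchy's formula on circles *)

Definition cis (t : R) : C := (cos (2 * PI * t), sin (2 * PI * t)).

Lemma Cmod_cis t : Cmod (cis t) = 1.
Proof.
unfold Cmod, cis, fst, snd. etransitivity; [|apply sqrt_1]. f_equal.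
generalize (sin2_cos2 (2 * PI * t)); unfold Rsqr; lra.
Qed.

Lemma cis_neq_0 t : cis t <> 0%C.
Proof. apply Cmod_gt_0. rewrite Cmod_cis; lra. Qed.

Lemma cis_0_1 : cis 0 = cis 1.
Proof.
unfold cis. rewrite Rmult_0_r, Rmult_1_r, cos_2PI, sin_2PI, cos_0, sin_0; reflexivity.
Qed.

Definition two_pi_i : C := (0, 2 * PI).

Lemma cderiv_cis t : cderiv cis t (two_pi_i * cis t)%C.
Proof.
split; unfold cis; simpl; auto_derive; trivial; ring.
Qed.

Lemma ccont_cis t : ccont cis t.
Proof. eapply cderiv_ccont, cderiv_cis. Qed.

Lemma cderiv_RtoC t : cderiv RtoC t 1%C.
Proof.
split; simpl; [apply (is_derive_id (K := R_AbsRing))|apply (is_derive_const (K := R_AbsRing) (V := R_NormedModule))].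
Qed.

Lemma Cmod_RtoC_pos r : 0 <= r -> Cmod (RtoC r) = r.
Proof. intro H; rewrite Cmod_R; apply Rabs_pos_eq, H. Qed.

Lemma RtoC_pos_neq_0 r : 0 < r -> RtoC r <> 0%C.
Proof. intro H; apply Cmod_gt_0; rewrite Cmod_RtoC_pos; lra. Qed.

(* The circles [p + t (b + s e^(2 i pi y))], [t1 <= t <= t2], form a homotopy shrinking towards [p]. *)
Lemma star_homotopy (f : C -> C) (p b s : C) (t1 t2 : R) :
  t1 <= t2 ->
  (forall t y, t1 <= t <= t2 -> cdiff f (p + t * (b + s * cis y))) ->
  cint (fun y => f (p + t1 * (b + s * cis y)) * (t1 * (s * cis y)))%C 0 1 =
  cint (fun y => f (p + t2 * (b + s * cis y)) * (t2 * (s * cis y)))%C 0 1.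
Proof.
intros Ht Hf.
set (D := RtoC (t2 - t1)). set (I := two_pi_i).
set (Z := fun x y : R => (p + (t1 + D * x) * (b + s * cis y))%C).
set (Z1 := fun x y : R => (D * (b + s * cis y))%C).
set (Z2 := fun x y : R => ((t1 + D * x) * (s * (I * cis y)))%C).
assert (Dz1 : forall x y, cderiv (fun t => Z t y) x (Z1 x y)).
{ intros x y.
  assert (H1 := cderiv_plus _ _ x _ _ (cderiv_const t1 x)
    (cderiv_mult _ _ x _ _ (cderiv_const D x) (cderiv_RtoC x))).
  assert (H := cderiv_plus _ _ x _ _ (cderiv_const p x)
    (cderiv_mult _ _ x _ _ H1 (cderiv_const (b + s * cis y) x))).
  cbv beta in H. match type of H with cderiv _ _ ?l =>
    replace (Z1 x y) with l by (unfold Z1; ring) end. exact H. }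
assert (Dz2 : forall x y, cderiv (fun t => Z x t) y (Z2 x y)).
{ intros x y.
  assert (H1 := cderiv_plus _ _ y _ _ (cderiv_const b y)
    (cderiv_mult _ _ y _ _ (cderiv_const s y) (cderiv_cis y))).
  assert (H := cderiv_plus _ _ y _ _ (cderiv_const p y)
    (cderiv_mult _ _ y _ _ (cderiv_const (t1 + D * x) y) H1)).
  cbv beta in H. match type of H with cderiv _ _ ?l =>
    replace (Z2 x y) with l by (unfold Z2, I; ring) end. exact H. }
assert (C1 : forall x y, ccont (fun t => Z1 t y) x) by (intros; apply ccont_const).
assert (C2 : forall x y, ccont (fun t => Z2 x t) y).
{ intros. apply ccont_mult; [apply ccont_const|]. apply ccont_mult; [apply ccont_const|].
  apply ccont_mult; [apply ccont_const|apply ccont_cis]. }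
assert (Ht12 : forall x, 0 <= x <= 1 -> t1 <= t1 + (t2 - t1) * x <= t2) by (intros; nra).
assert (Hfz : forall x y, 0 <= x <= 1 -> 0 <= y <= 1 -> cdiff f (Z x y)).
{ intros x y Hx Hy. unfold Z, D. rewrite <- RtoC_mult, <- RtoC_plus. apply Hf, Ht12, Hx. }
set (L1 := Cmod D * (Cmod b + Cmod s)).
set (L2 := (Cmod t1 + Cmod D) * (Cmod s * Cmod I)).
assert (HL : forall x y, 0 <= x <= 1 -> 0 <= y <= 1 -> Cmod (Z1 x y) <= L1 + L2 /\ Cmod (Z2 x y) <= L1 + L2).
{ intros x y Hx Hy.
  assert (P1 := Cmod_ge_0 b); assert (P2 := Cmod_ge_0 s); assert (P3 := Cmod_ge_0 D);
  assert (P4 := Cmod_ge_0 I); assert (P5 := Cmod_ge_0 t1).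
  assert (0 <= L1) by (unfold L1; apply Rmult_le_pos; lra).
  assert (0 <= L2) by (unfold L2; apply Rmult_le_pos; [lra|apply Rmult_le_pos; lra]).
  split.
  - apply Rle_trans with L1; [|lra]. unfold Z1, L1. rewrite Cmod_mult.
    apply Rmult_le_compat_l; [assumption|]. eapply Rle_trans; [apply Cmod_triangle|].
    rewrite Cmod_mult, Cmod_cis; lra.
  - apply Rle_trans with L2; [|lra]. unfold Z2, L2. rewrite !Cmod_mult, Cmod_cis, Rmult_1_r.
    apply Rmult_le_compat_r; [apply Rmult_le_pos; assumption|].
    eapply Rle_trans; [apply Cmod_triangle|]. rewrite Cmod_mult.
    rewrite (Cmod_RtoC_pos x) by lra. nra. }
assert (G := goursat f Z Z1 Z2 (L1 + L2) Dz1 Dz2 C1 C2 HL Hfz).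
unfold square_boundary_integral in G. rewrite !Rplus_0_l in G.
(* The sides [y = 0] and [y = 1] have the same image because [cis] has period 1, so they cancel. *)
assert (E1 : cint (fun t => f (Z t 0) * Z1 t 0)%C 0 1 = cint (fun t => f (Z t 1) * Z1 t 1)%C 0 1)
  by (unfold Z, Z1; rewrite cis_0_1; reflexivity).
assert (I0 : I <> 0%C).
{ apply Cmod_gt_0. eapply Rlt_le_trans; [|apply abs_snd_le]. simpl.
  assert (H := PI_RGT_0). rewrite Rabs_pos_eq; lra. }
(* The other two sides are the extreme circles of the homotopy, up to the factor [I] that
   differentiating [cis] produces. *)
assert (E2 : forall x (t : R), 0 <= x <= 1 -> (t1 + D * x)%C = t ->
  cint (fun y => f (Z x y) * Z2 x y)%C 0 1 =
  (I * cint (fun y => f (p + t * (b + s * cis y)) * (t * (s * cis y))) 0 1)%C).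
{ intros x t Hx Hxt. rewrite <- cint_scal; [|lra|].
  - apply cint_ext; [lra|]. intros y Hy. unfold Z, Z2. rewrite Hxt. ring.
  - intros y Hy. apply ccont_mult.
    + apply (ccont_comp f (fun y => p + t * (b + s * cis y))%C).
      * apply ccont_plus; [apply ccont_const|]. apply ccont_mult; [apply ccont_const|].
        apply ccont_plus; [apply ccont_const|].
        apply ccont_mult; [apply ccont_const|apply ccont_cis].
      * rewrite <- Hxt. apply (Hfz x y Hx Hy).
    + repeat (apply ccont_mult; [apply ccont_const|]). apply ccont_cis. }
rewrite E1 in G.
rewrite (E2 0 t1), (E2 1 t2) in G;
  [|lra|unfold D; rewrite RtoC_minus; ring|lra|ring].
set (J1 := cint (fun y => f (p + t1 * (b + s * cis y)) * (t1 * (s * cis y)))%C 0 1) in *.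
set (J2 := cint (fun y => f (p + t2 * (b + s * cis y)) * (t2 * (s * cis y)))%C 0 1) in *.
match type of G with (?A + _ - _ - _)%C = _ => generalize A G end. intros A G'.
apply Cminus_eq_0.
replace (J1 - J2)%C with (- / I * (A + I * J2 - A - I * J1))%C by (field; exact I0).
rewrite G'; ring.
Qed.

Lemma ccont_bounded F : (forall t, 0 <= t <= 1 -> ccont F t) ->
  exists M, 0 <= M /\ forall t, 0 <= t <= 1 -> Cmod (F t) <= M.
Proof.
intro H.
(* The predicate ignores [x], so quartering the square amounts to halving [[0, 1]]. *)
destruct (square_induction (fun _ y l => exists M, forall t, y <= t <= y + l -> Cmod (F t) <= M))
  as [M HM].
- intros x y l _ _ _ _ _ [M1 H1] _ [M2 H2] _. exists (Rmax M1 M2). intros t Ht.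
  destruct (Rle_dec t (y + l / 2)).
  + eapply Rle_trans; [apply H1; lra|apply Rmax_l].
  + eapply Rle_trans; [apply H2; lra|apply Rmax_r].
- intros u v _ Hv. destruct (proj1 (ccont_eps F v) (H v Hv) 1 Rlt_0_1) as [d [Hd Hd']].
  exists d; split; [exact Hd|]. intros x y l Hl _ _ _ _ _ Hy.
  exists (Cmod (F v) + 1). intros t Ht.
  replace (F t) with (F v + (F t - F v))%C by ring.
  eapply Rle_trans; [apply Cmod_triangle|].
  apply Rplus_le_compat_l, Rlt_le, Hd', Rabs_lt_between'; lra.
- exists M; split.
  + eapply Rle_trans; [apply Cmod_ge_0|apply (HM 0); lra].
  + intros t Ht; apply HM; lra.
Qed.

Lemma cdiff_quotient f z p : cdiff f z -> z <> p -> cdiff (fun w => f w * / (w - p))%C z.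
Proof.
intros Hf Hzp.
assert (Hz : (z - p)%C <> 0%C)
  by (intro E; apply Hzp, Cminus_eq_0, E).
assert (Hm : 0 < Cmod (z - p)) by (apply Cmod_gt_0, Hz).
set (m := Cmod (z - p)) in *.
assert (Hc := cdiff_continuous f z Hf). destruct Hf as [l Hl].
set (B := Cmod (f z) + Cmod l * m).
assert (HB : 0 <= B) by (apply Rplus_le_le_0_compat; [|apply Rmult_le_pos]; try apply Cmod_ge_0; lra).
exists ((l * (z - p) - f z) * / ((z - p) * (z - p)))%C. intros eps He.
(* Keeping [w] at distance at least [m / 2] from [p] gives [/ Cmod (w - p) <= 2 / m]. The other two
   radii make each summand of [HE] below at most [eps / 2 * Cmod (w - z)]. *)
destruct (Hl (eps * m / 4)) as [d1 [Hd1 Hd1']]; [apply Rdiv_lt_0_compat; nra|].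
assert (Hq : 0 < eps * (m * m * m) / (4 * (B + 1))).
{ apply Rdiv_lt_0_compat; [|lra]. repeat apply Rmult_lt_0_compat; lra. }
exists (Rmin d1 (Rmin (m / 2) (eps * (m * m * m) / (4 * (B + 1))))); split.
{ repeat apply Rmin_glb_lt; lra. }
intros w Hw.
assert (Hw1 := Rlt_le_trans _ _ _ Hw (Rmin_l _ _)).
assert (Hw2 := Rlt_le_trans _ _ _ Hw (Rmin_r _ _)).
assert (Hw3 := Rlt_le_trans _ _ _ Hw2 (Rmin_r _ _)).
apply (fun H => Rlt_le_trans _ _ _ H (Rmin_l _ _)) in Hw2.
specialize (Hd1' w Hw1).
assert (Hwp : m / 2 <= Cmod (w - p)).
{ assert (m <= Cmod (w - p) + Cmod (w - z)); [|lra].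
  unfold m. replace (z - p)%C with ((w - p) + - (w - z))%C by ring.
  eapply Rle_trans; [apply Cmod_triangle|]. rewrite Cmod_opp; lra. }
assert (Hw0 : (w - p)%C <> 0%C) by (apply Cmod_gt_0; lra).
assert (HE : (f w * / (w - p) - f z * / (z - p) -
  (l * (z - p) - f z) * / ((z - p) * (z - p)) * (w - z))%C =
  ((f w - f z - l * (w - z)) * / (w - p) +
   (f z - l * (z - p)) * ((w - z) * (w - z)) * / ((w - p) * ((z - p) * (z - p))))%C)
  by (field; split; assumption).
rewrite HE. eapply Rle_trans; [apply Cmod_triangle|].
assert (Hi : / Cmod (w - p) <= 2 / m).
{ replace (2 / m) with (/ (m / 2)) by (field; lra). apply Rinv_le_contravar; lra. }
assert (Hi0 : 0 < / Cmod (w - p)) by (apply Rinv_0_lt_compat; lra).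
assert (HB' : Cmod (f z - l * (z - p)) <= B).
{ unfold Cminus at 1. eapply Rle_trans; [apply Cmod_triangle|].
  rewrite Cmod_opp, Cmod_mult; fold m; unfold B; lra. }
rewrite !Cmod_mult, Cmod_inv, Cmod_inv, !Cmod_mult by (repeat apply Cmult_neq_0; assumption).
fold m. set (h := Cmod (w - z)) in *.
assert (Hh : 0 <= h) by apply Cmod_ge_0.
apply Rle_trans with (eps * m / 4 * h * (2 / m) + B * (h * h) * (2 / m * / (m * m))).
- apply Rplus_le_compat.
  + apply Rmult_le_compat; try lra; apply Cmod_ge_0.
  + rewrite Rinv_mult. apply Rmult_le_compat.
    * apply Rmult_le_pos; [apply Cmod_ge_0|nra].
    * apply Rmult_le_pos; [lra|]. left; apply Rinv_0_lt_compat; nra.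
    * apply Rmult_le_compat_r; [nra|exact HB'].
    * apply Rmult_le_compat_r; [|exact Hi]. left; apply Rinv_0_lt_compat; nra.
- replace (eps * m / 4 * h * (2 / m)) with (eps / 2 * h) by (field; lra).
  assert (B * h * (2 / m * / (m * m)) <= eps / 2); [|nra].
  apply Rle_trans with ((B + 1) * (eps * (m * m * m) / (4 * (B + 1))) * (2 / m * / (m * m))).
  + apply Rmult_le_compat_r; [|nra].
    apply Rmult_le_pos; [apply Rdiv_le_0_compat; lra|left; apply Rinv_0_lt_compat; nra].
  + right; field; lra.
Qed.

Lemma cdiff_ext f g z : (forall w, f w = g w) -> cdiff f z -> cdiff g z.
Proof.
intros E [l Hl]; exists l; intros eps He; destruct (Hl eps He) as [d [Hd Hd']].
exists d; split; trivial. intros w Hw; rewrite <- !E; auto.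
Qed.

Lemma cdiff_quotient_pow f z p n : cdiff f z -> z <> p -> cdiff (fun w => f w * (/ (w - p)) ^ n)%C z.
Proof.
intros Hf Hzp. induction n as [|n IH].
- apply cdiff_ext with f; [intro; simpl; ring|exact Hf].
- apply cdiff_ext with (fun w => f w * (/ (w - p)) ^ n * / (w - p))%C.
  + intro; simpl; ring.
  + apply cdiff_quotient; assumption.
Qed.

(** * Taylor coefficients as averages over circles *)

Definition circle (a : C) (s t : R) : C := (a + s * cis t)%C.

(* The [k]-th Taylor coefficient at [a]: on the circle, [dw / (2 i pi (w - a))] is [dt]. *)
Definition coef (f : C -> C) (a : C) (s : R) (k : nat) : C :=
  cint (fun t => f (circle a s t) * (/ (s * cis t)) ^ k)%C 0 1.

Lemma ccont_circle a s t : ccont (circle a s) t.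
Proof.
apply ccont_plus; [apply ccont_const|].
apply ccont_mult; [apply ccont_const|apply ccont_cis].
Qed.

Lemma Cmod_circle a s t : 0 <= s -> Cmod (circle a s t - a) = s.
Proof.
intro H. replace (circle a s t - a)%C with (s * cis t)%C by (unfold circle; ring).
rewrite Cmod_mult, Cmod_cis, Cmod_RtoC_pos by assumption; ring.
Qed.

Lemma scis_neq_0 s t : 0 < s -> (s * cis t)%C <> 0%C.
Proof. intro H; apply Cmult_neq_0; [apply RtoC_pos_neq_0, H|apply cis_neq_0]. Qed.

Lemma ccont_scis_inv_pow s k t : 0 < s -> ccont (fun t => (/ (s * cis t)) ^ k)%C t.
Proof.
intro H. apply ccont_pow. apply ccont_inv; [|apply scis_neq_0, H].
apply ccont_mult; [apply ccont_const|apply ccont_cis].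
Qed.

Lemma ccont_coef_integrand f a s k t : 0 < s -> (forall w, Cmod (w - a) = s -> cdiff f w) ->
  ccont (fun t => f (circle a s t) * (/ (s * cis t)) ^ k)%C t.
Proof.
intros Hs Hf. apply ccont_mult; [|apply ccont_scis_inv_pow, Hs].
apply (ccont_comp f (circle a s)); [apply ccont_circle|apply Hf, Cmod_circle; lra].
Qed.

Lemma Cmod_scis_inv_pow s t k : 0 < s -> Cmod ((/ (s * cis t)) ^ k)%C = (/ s) ^ k.
Proof.
intro H. rewrite Cmod_pow, Cmod_inv, Cmod_mult, Cmod_cis, Rmult_1_r, Cmod_RtoC_pos by
  first [lra | apply scis_neq_0, H]. reflexivity.
Qed.

(** [star_homotopy] with [p = a], [b = 0], [s = 1] and the radius as parameter, applied to
    [f w / (w - a)^(k+1)]; the exponent is [S k] because the factor [t * (s * cis y)] there is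
    [w - a]. *)
Lemma coef_radius f a s1 s2 k : 0 < s1 <= s2 ->
  (forall w, s1 <= Cmod (w - a) <= s2 -> cdiff f w) -> coef f a s1 k = coef f a s2 k.
Proof.
intros Hs Hf.
assert (E : forall s, s1 <= s <= s2 -> coef f a s k =
  cint (fun y => (f (a + s * (0 + 1 * cis y)) * (/ ((a + s * (0 + 1 * cis y)) - a)) ^ (S k)) *
        (s * (1 * cis y)))%C 0 1).
{ intros s Hs'. apply cint_ext; [lra|]. intros t _. unfold circle.
  replace (a + s * (0 + 1 * cis t))%C with (a + s * cis t)%C by ring.
  replace (a + s * cis t - a)%C with (s * cis t)%C by ring.
  rewrite Cpow_S. field. split; [apply cis_neq_0|apply RtoC_pos_neq_0; lra]. }
rewrite (E s1), (E s2) by lra.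
apply (star_homotopy (fun w => f w * (/ (w - a)) ^ (S k))%C a 0 1 s1 s2); [lra|].
intros t y Ht.
replace (a + t * (0 + 1 * cis y))%C with (circle a t y) by (unfold circle; ring).
assert (Hm : Cmod (circle a t y - a) = t) by (apply Cmod_circle; lra).
apply cdiff_quotient_pow.
- apply Hf; lra.
- intro H. rewrite H in Hm. replace (a - a)%C with (RtoC 0) in Hm by ring.
  rewrite Cmod_0 in Hm; lra.
Qed.

(** Cauchy's estimate, with the factor 2 of [cint_bound]. *)
Lemma coef_bound f a s k M : 0 < s -> (forall w, Cmod (w - a) = s -> cdiff f w) ->
  (forall t, 0 <= t <= 1 -> Cmod (f (circle a s t)) <= M) ->
  Cmod (coef f a s k) <= 2 * M * (/ s) ^ k.
Proof.
intros Hs Hf HM.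
apply Rle_trans with (2 * (1 - 0) * (M * (/ s) ^ k)); [|right; ring].
apply cint_bound; [lra|..].
- intros; apply ccont_coef_integrand; assumption.
- intros t Ht. rewrite Cmod_mult, Cmod_scis_inv_pow by assumption.
  apply Rmult_le_compat_r; [|auto]. apply pow_le. left; apply Rinv_0_lt_compat, Hs.
Qed.

Fixpoint csum (c : nat -> C) (n : nat) : C :=
  match n with O => RtoC 0 | S n => (csum c n + c n)%C end.

Section Cauchy.
Variables (a z : C) (s : R).
Hypothesis Hs : 0 < s.
Hypothesis Hz : Cmod (z - a) < s.

(** Cauchy's kernel: for [w = circle a s t], the form [dw / (2 i pi (w - z))] is [K t dt]. *)
Let K (t : R) : C := (s * cis t * / (a - z + s * cis t))%C.

Let gamma_bound t : s - Cmod (z - a) <= Cmod (a - z + s * cis t).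
Proof.
assert (H : s <= Cmod (a - z + s * cis t) + Cmod (z - a)); [|lra].
apply Rle_trans with (Cmod (s * cis t)).
- rewrite Cmod_mult, Cmod_cis, Cmod_RtoC_pos; lra.
- replace (s * cis t)%C with ((a - z + s * cis t) + (z - a))%C at 1 by ring. apply Cmod_triangle.
Qed.

Let gamma_neq_0 t : (a - z + s * cis t)%C <> 0%C.
Proof. apply Cmod_gt_0. generalize (gamma_bound t); lra. Qed.

Let ccont_K t : ccont K t.
Proof.
apply ccont_mult.
- apply ccont_mult; [apply ccont_const|apply ccont_cis].
- apply (ccont_inv (fun t => a - z + s * cis t)%C); [|apply gamma_neq_0].
  apply ccont_plus; [apply ccont_const|].
  apply ccont_mult; [apply ccont_const|apply ccont_cis].
Qed.

Let Kmax := s / (s - Cmod (z - a)).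

Let K_bound t : Cmod (K t) <= Kmax.
Proof.
unfold K, Kmax. rewrite Cmod_mult, Cmod_mult, Cmod_cis, Cmod_inv, Cmod_RtoC_pos by
  first [lra | apply gamma_neq_0].
rewrite Rmult_1_r. apply Rmult_le_compat_l; [lra|].
apply Rinv_le_contravar; [lra|apply gamma_bound].
Qed.

Let Kmax_pos : 0 < Kmax.
Proof. apply Rdiv_lt_0_compat; lra. Qed.

(* Shrink the circle towards [z] by [star_homotopy] applied to [f w / (w - z)]. *)
Lemma cauchy_kernel f : (forall w, Cmod (w - a) <= s -> cdiff f w) ->
  cint (fun t => f (circle a s t) * K t)%C 0 1 = (f z * cint K 0 1)%C.
Proof.
intros Hf.
assert (Hin : forall (r : R) t, 0 <= r <= 1 -> Cmod (z + r * (a - z + s * cis t) - a) <= s).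
{ intros r t Hr.
  replace (z + r * (a - z + s * cis t) - a)%C with ((1 - r)%R * (z - a) + r * (s * cis t))%C
    by (rewrite RtoC_minus; ring).
  eapply Rle_trans; [apply Cmod_triangle|].
  rewrite !Cmod_mult, Cmod_cis, !Cmod_RtoC_pos by lra.
  apply Rle_trans with ((1 - r) * s + r * (s * 1)); [|lra].
  apply Rplus_le_compat_r, Rmult_le_compat_l; lra. }
(* The contraction ratio cancels between [dw] and [w - z], so the kernel stays [K]. The ratio 0 is
   excluded because [f w / (w - z)] is singular at [z]; continuity of [f] at [z] replaces it. *)
assert (E : forall r, 0 < r <= 1 ->
  cint (fun t => f (circle a s t) * K t)%C 0 1 =
  cint (fun t => f (z + r * (a - z + s * cis t)) * K t)%C 0 1).
{ intros r Hr.
  assert (H := star_homotopy (fun w => f w * / (w - z))%C z (a - z) s r 1 (proj2 Hr)).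
  assert (E : forall r', 0 < r' <= 1 ->
    cint (fun t => f (z + r' * (a - z + s * cis t)) * K t)%C 0 1 =
    cint (fun y => f (z + r' * (a - z + s * cis y)) *
      / (z + r' * (a - z + s * cis y) - z) * (r' * (s * cis y)))%C 0 1).
  { intros r' Hr'. apply cint_ext; [lra|]. intros t _. unfold K.
    replace (z + r' * (a - z + s * cis t) - z)%C with (r' * (a - z + s * cis t))%C by ring.
    field. split; [apply gamma_neq_0|apply RtoC_pos_neq_0; lra]. }
  rewrite (E r Hr), H.
  - rewrite <- (E 1) by lra. apply cint_ext; [lra|]. intros t _. f_equal. f_equal.
    unfold circle; ring.
  - intros t y Ht. apply cdiff_quotient; [apply Hf, Hin; lra|].
    intro Q.
    assert (Q' : (t * (a - z + s * cis y))%C = 0%C).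
    { replace (t * (a - z + s * cis y))%C with (z + t * (a - z + s * cis y) - z)%C by ring.
      rewrite Q; ring. }
    revert Q'. apply Cmult_neq_0; [apply RtoC_pos_neq_0; lra|apply gamma_neq_0]. }
assert (Hcz : cdiff f z) by (apply Hf; lra).
apply Cminus_eq_0, Cmod_eq_0, Rle_antisym; [|apply Cmod_ge_0].
apply le_epsilon; intros eps He. rewrite Rplus_0_l.
destruct (cdiff_continuous f z Hcz (eps / (2 * Kmax))) as [d [Hd Hd']].
{ apply Rdiv_lt_0_compat; lra. }
(* The contracted circle stays within [2 * s * r] of [z], which is at most two thirds of [d]. *)
set (r := Rmin 1 (d / (3 * s))).
assert (Hd3 : 0 < d / (3 * s)) by (apply Rdiv_lt_0_compat; lra).
assert (Hr : 0 < r <= 1) by (split; [apply Rmin_glb_lt; lra|apply Rmin_l]).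
assert (Hrd : r * (2 * s) < d).
{ apply Rle_lt_trans with (d / (3 * s) * (2 * s)).
  - apply Rmult_le_compat_r; [lra|apply Rmin_r].
  - replace (d / (3 * s) * (2 * s)) with (2 / 3 * d) by (field; lra). lra. }
assert (Cfr : forall t, ccont (fun t => f (z + r * (a - z + s * cis t)) * K t)%C t).
{ intro t. apply ccont_mult; [|apply ccont_K].
  apply (ccont_comp f (fun t => z + r * (a - z + s * cis t))%C).
  - apply ccont_plus; [apply ccont_const|]. apply ccont_mult; [apply ccont_const|].
    apply ccont_plus; [apply ccont_const|].
    apply ccont_mult; [apply ccont_const|apply ccont_cis].
  - apply Hf, Hin; lra. }
rewrite (E r Hr), <- cint_scal, <- cint_minus; [|lra|auto|..|lra|auto].
2: intros t _; apply ccont_mult; [apply ccont_const|apply ccont_K].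
apply Rle_trans with (2 * (1 - 0) * (eps / (2 * Kmax) * Kmax)); [|right; field; lra].
apply cint_bound; [lra|..].
- intros t _; apply ccont_minus; [auto|]. apply ccont_mult; [apply ccont_const|apply ccont_K].
- intros t _.
  replace (f (z + r * (a - z + s * cis t)) * K t - f z * K t)%C with
    ((f (z + r * (a - z + s * cis t)) - f z) * K t)%C by ring.
  rewrite Cmod_mult. apply Rmult_le_compat; try apply Cmod_ge_0; [|apply K_bound].
  left; apply Hd'.
  replace (z + r * (a - z + s * cis t) - z)%C with (r * (a - z + s * cis t))%C by ring.
  rewrite Cmod_mult, Cmod_RtoC_pos by lra.
  apply Rle_lt_trans with (r * (2 * s)); [|exact Hrd].
  apply Rmult_le_compat_l; [lra|].
  eapply Rle_trans; [apply Cmod_triangle|].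
  rewrite Cmod_mult, Cmod_cis, Cmod_RtoC_pos by lra.
  replace (a - z)%C with (- (z - a))%C by ring. rewrite Cmod_opp; lra.
Qed.

(** Iterates [K t = 1 + (z - a) / (s * cis t) * K t], a finite geometric sum, so that no series is
    integrated term by term. *)
Lemma kernel_expansion f n : (forall w, Cmod (w - a) <= s -> cdiff f w) ->
  cint (fun t => f (circle a s t) * K t)%C 0 1 =
  (csum (fun k => coef f a s k * (z - a) ^ k) n +
   (z - a) ^ n * cint (fun t => f (circle a s t) * (/ (s * cis t)) ^ n * K t) 0 1)%C.
Proof.
intro Hf.
assert (Hf' : forall w, Cmod (w - a) = s -> cdiff f w) by (intros; apply Hf; lra).
assert (HC : forall k t, ccont (fun t => f (circle a s t) * (/ (s * cis t)) ^ k * K t)%C t)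
  by (intros; apply ccont_mult; [apply ccont_coef_integrand; assumption|apply ccont_K]).
induction n as [|n IH].
- simpl. rewrite Cplus_0_l, Cmult_1_l. apply cint_ext; [lra|]. intros; ring.
- rewrite IH.
  assert (E : cint (fun t => f (circle a s t) * (/ (s * cis t)) ^ n * K t)%C 0 1 =
    (coef f a s n + (z - a) * cint (fun t => f (circle a s t) * (/ (s * cis t)) ^ (S n) * K t) 0 1)%C).
  { unfold coef. rewrite <- cint_scal, <- cint_plus; [|lra|..|lra|auto].
    - apply cint_ext; [lra|]. intros t _. unfold K. rewrite Cpow_S.
      field. split; [apply gamma_neq_0|split; [apply cis_neq_0|apply RtoC_pos_neq_0, Hs]].
    - intros; apply ccont_coef_integrand; assumption.
    - intros; apply ccont_mult; [apply ccont_const|apply HC]. }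
  rewrite E. cbn [csum Cpow]. ring.
Qed.

Lemma kernel_remainder f : (forall w, Cmod (w - a) <= s -> cdiff f w) ->
  exists B, forall n,
  Cmod (cint (fun t => f (circle a s t) * K t)%C 0 1 - csum (fun k => coef f a s k * (z - a) ^ k) n)%C
    <= B * (Cmod (z - a) / s) ^ n.
Proof.
intro Hf.
assert (Hf' : forall w, Cmod (w - a) = s -> cdiff f w) by (intros; apply Hf; lra).
destruct (ccont_bounded (fun t => f (circle a s t))) as [M [HM HM']].
{ intros t _. apply (ccont_comp f (circle a s)); [apply ccont_circle|apply Hf', Cmod_circle; lra]. }
exists (2 * M * Kmax). intro n. rewrite (kernel_expansion f n Hf).
match goal with |- Cmod (?A + ?B - ?A)%C <= _ => replace (A + B - A)%C with B by ring end.
rewrite Cmod_mult, Cmod_pow.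
apply Rle_trans with (Cmod (z - a) ^ n * (2 * (1 - 0) * (M * (/ s) ^ n * Kmax))).
- apply Rmult_le_compat_l; [apply pow_le, Cmod_ge_0|].
  apply cint_bound; [lra|..].
  + intros; apply ccont_mult; [apply ccont_coef_integrand; assumption|apply ccont_K].
  + intros t Ht. rewrite !Cmod_mult, Cmod_scis_inv_pow by assumption.
    assert (0 <= (/ s) ^ n) by (apply pow_le; left; apply Rinv_0_lt_compat, Hs).
    apply Rmult_le_compat; [|apply Cmod_ge_0|..|apply K_bound].
    * apply Rmult_le_pos; [apply Cmod_ge_0|assumption].
    * apply Rmult_le_compat_r; auto.
- unfold Rdiv. rewrite Rpow_mult_distr. right; ring.
Qed.
End Cauchy.

(** * Taylor expansion and the identity theorem *)

Lemma geometric_small q eps : 0 <= q < 1 -> 0 < eps -> exists n, q ^ n < eps.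
Proof.
intros Hq He. destruct (pow_lt_1_zero q) with (y := eps) as [N HN]; [rewrite Rabs_pos_eq; lra|exact He|].
exists N. specialize (HN N (le_n N)). rewrite Rabs_pos_eq in HN; [exact HN|apply pow_le; lra].
Qed.

(** Uniqueness of limits, in a form that requires no notion of convergence in the complex plane. *)
Lemma eq_of_geometric_bound x y (u : nat -> C) B q : 0 <= q < 1 ->
  (forall n, Cmod (x - u n) <= B * q ^ n) -> (forall n, Cmod (y - u n) <= B * q ^ n) -> x = y.
Proof.
intros Hq Hx Hy.
apply Cminus_eq_0, Cmod_eq_0, Rle_antisym; [|apply Cmod_ge_0].
apply le_epsilon; intros eps He. rewrite Rplus_0_l.
destruct (geometric_small q (eps / (2 * Rabs B + 1)) Hq) as [n Hn].
{ apply Rdiv_lt_0_compat; [|generalize (Rabs_pos B)]; lra. }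
apply Rlt_div_r in Hn; [|generalize (Rabs_pos B); lra].
replace (x - y)%C with ((x - u n) + - (y - u n))%C by ring.
eapply Rle_trans; [apply Cmod_triangle|]. rewrite Cmod_opp.
specialize (Hx n); specialize (Hy n).
assert (0 <= q ^ n) by (apply pow_le; lra).
assert (B * q ^ n <= Rabs B * q ^ n) by (apply Rmult_le_compat_r; [assumption|apply Rle_abs]).
lra.
Qed.

Lemma cdiff_const c z : cdiff (fun _ => c) z.
Proof.
exists 0%C. intros eps He; exists 1; split; [lra|]. intros w _.
replace (c - c - 0 * (w - z))%C with (RtoC 0) by ring. rewrite Cmod_0.
apply Rmult_le_pos; [lra|apply Cmod_ge_0].
Qed.

Lemma coef_one_0 a s : coef (fun _ => 1%C) a s 0 = 1%C.
Proof.
unfold coef. rewrite (cint_ext 0 1 ltac:(lra) _ (fun _ => 1%C)) by (intros; simpl; ring).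
rewrite (cint_deriv 0 1 ltac:(lra) RtoC (fun _ => 1%C)).
- ring.
- intros; apply cderiv_RtoC.
- intros; apply ccont_const.
Qed.

(* The coefficient does not depend on the radius and is [O(1/r)] as the radius grows. *)
Lemma coef_one_S a s k : 0 < s -> coef (fun _ => 1%C) a s (S k) = 0%C.
Proof.
intro Hs. apply Cmod_eq_0, Rle_antisym; [|apply Cmod_ge_0].
apply le_epsilon; intros eps He. rewrite Rplus_0_l.
assert (H2 : 0 < 2 / eps) by (apply Rdiv_lt_0_compat; lra).
set (r := s + 1 + 2 / eps).
rewrite (coef_radius _ a s r) by (try (intros; apply cdiff_const); unfold r; lra).
eapply Rle_trans.
- apply (coef_bound (fun _ => 1%C) a r (S k) 1); [unfold r; lra|intros; apply cdiff_const|].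
  intros; rewrite Cmod_1; lra.
- assert (Hr : 0 < / r) by (apply Rinv_0_lt_compat; unfold r; lra).
  assert (Hr1 : / r <= 1) by (rewrite <- Rinv_1; apply Rinv_le_contravar; unfold r; lra).
  assert (Hre : / r <= eps / 2).
  { replace (eps / 2) with (/ (2 / eps)) by (field; lra).
    apply Rinv_le_contravar; unfold r; lra. }
  assert ((/ r) ^ k <= 1) by (rewrite <- (pow1 k); apply pow_incr; lra).
  assert (0 <= (/ r) ^ k) by (apply pow_le; lra).
  simpl. nra.
Qed.

(** [cauchy_kernel] leaves the unknown factor [J], the integral of the kernel. The expansion for the
    constant function 1, with coefficients 1, 0, 0, ..., forces [J = 1]. *)
Lemma taylor f a s z : Cmod (z - a) < s -> (forall w, Cmod (w - a) <= s -> cdiff f w) ->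
  exists B, forall n,
    Cmod (f z - csum (fun k => coef f a s k * (z - a) ^ k) n)%C <= B * (Cmod (z - a) / s) ^ n.
Proof.
intros Hz Hf.
assert (Hs : 0 < s) by (generalize (Cmod_ge_0 (z - a)); lra).
assert (Hq : 0 <= Cmod (z - a) / s < 1).
{ split; [apply Rdiv_le_0_compat; [apply Cmod_ge_0|exact Hs]|].
  apply Rlt_div_l; lra. }
destruct (kernel_remainder a z s Hs Hz f Hf) as [B HB].
rewrite (cauchy_kernel a z s Hs Hz f Hf) in HB.
destruct (kernel_remainder a z s Hs Hz (fun _ => 1%C)) as [B1 HB1];
  [intros; apply cdiff_const|].
rewrite (cint_ext 0 1 ltac:(lra) _ (fun t => s * cis t * / (a - z + s * cis t))%C) in HB1
  by (intros; ring).
match type of HB with context [(f z * ?j)%C] => set (J := j) in * end.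
assert (HJ : J = 1%C).
(* The index is [S n] because the empty sum is 0, whereas every nonempty partial sum equals 1. *)
{ apply (eq_of_geometric_bound J 1%C
    (fun n => csum (fun k => coef (fun _ => 1%C) a s k * (z - a) ^ k)%C (S n)) (Rabs B1) _ Hq).
  - intro n. eapply Rle_trans; [apply (HB1 (S n))|].
    set (q := Cmod (z - a) / s) in *. simpl.
    assert (0 <= q ^ n) by (apply pow_le; lra).
    apply Rle_trans with (Rabs B1 * (q * q ^ n)).
    + apply Rmult_le_compat_r; [nra|apply Rle_abs].
    + apply Rmult_le_compat_l; [apply Rabs_pos|nra].
  - intro n.
    replace (csum (fun k => coef (fun _ => 1%C) a s k * (z - a) ^ k)%C (S n)) with (RtoC 1).
    + replace (1 - 1)%C with (RtoC 0) by ring. rewrite Cmod_0.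
      apply Rmult_le_pos; [apply Rabs_pos|apply pow_le; lra].
    + induction n as [|n IH].
      * simpl. rewrite coef_one_0. ring.
      * change (csum ?c (S (S n))) with (csum c (S n) + c (S n))%C.
        rewrite <- IH, coef_one_S by exact Hs. ring. }
exists B. intro n. specialize (HB n). rewrite HJ, Cmult_1_r in HB. exact HB.
Qed.

Lemma csum_ext c d n : (forall k, c k = d k) -> csum c n = csum d n.
Proof. intro H; induction n as [|n IH]; simpl; [reflexivity|]. rewrite IH, H; reflexivity. Qed.

Lemma eq_of_coef_eq f g a s z : Cmod (z - a) < s ->
  (forall w, Cmod (w - a) <= s -> cdiff f w) -> (forall w, Cmod (w - a) <= s -> cdiff g w) ->
  (forall k, coef f a s k = coef g a s k) -> f z = g z.
Proof.
intros Hz Hf Hg E.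
assert (Hs : 0 < s) by (generalize (Cmod_ge_0 (z - a)); lra).
assert (Hq : 0 <= Cmod (z - a) / s < 1).
{ split; [apply Rdiv_le_0_compat; [apply Cmod_ge_0|exact Hs]|].
  apply Rlt_div_l; lra. }
destruct (taylor f a s z Hz Hf) as [B HB]. destruct (taylor g a s z Hz Hg) as [B' HB'].
assert (Hp : forall n, 0 <= (Cmod (z - a) / s) ^ n) by (intro; apply pow_le; lra).
apply (eq_of_geometric_bound _ _ (fun n => csum (fun k => coef f a s k * (z - a) ^ k)%C n)
  (Rmax B B') _ Hq); intro n.
- eapply Rle_trans; [apply HB|]. apply Rmult_le_compat_r; [apply Hp|apply Rmax_l].
- rewrite (csum_ext _ (fun k => coef g a s k * (z - a) ^ k)%C) by (intro; rewrite E; reflexivity).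
  eapply Rle_trans; [apply HB'|]. apply Rmult_le_compat_r; [apply Hp|apply Rmax_r].
Qed.

Lemma coef_ext f g a s k : (forall t, f (circle a s t) = g (circle a s t)) ->
  coef f a s k = coef g a s k.
Proof. intro H; apply cint_ext; [lra|]. intros t _; rewrite H; reflexivity. Qed.

(** The coefficients may be computed on a circle so small that [f] and [g] agree on it, and they
    determine both functions on every larger disk inside [D (a, R)]. *)
Lemma eq_on_disk f g a r R : 0 < r ->
  (forall w, Cmod (w - a) < R -> cdiff f w) -> (forall w, Cmod (w - a) < R -> cdiff g w) ->
  (forall w, Cmod (w - a) < r -> f w = g w) -> forall z, Cmod (z - a) < R -> f z = g z.
Proof.
intros Hr Hf Hg E z Hz.
set (s := (Cmod (z - a) + R) / 2). set (s1 := Rmin (r / 2) s).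
assert (H0 := Cmod_ge_0 (z - a)).
assert (Hs1 : 0 < s1) by (apply Rmin_glb_lt; unfold s; lra).
assert (H1 := Rmin_l (r / 2) s). assert (H2 := Rmin_r (r / 2) s). fold s1 in H1, H2.
apply (eq_of_coef_eq f g a s z); [unfold s; lra|intros; apply Hf; unfold s in *; lra
  |intros; apply Hg; unfold s in *; lra|].
intro k.
rewrite <- (coef_radius f a s1 s), <- (coef_radius g a s1 s) by
  (try (intros; first [apply Hf|apply Hg]); unfold s in *; lra).
apply coef_ext. intro t. apply E. rewrite Cmod_circle; lra.
Qed.

Lemma identity_theorem f g S p r : is_open S -> open_connected S ->
  (forall w, S w -> cdiff f w) -> (forall w, S w -> cdiff g w) ->
  S p -> 0 < r -> (forall w, Cmod (w - p) < r -> f w = g w) -> forall z, S z -> f z = g z.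
Proof.
intros HS Hc Hf Hg Hp Hr E.
set (A := fun w : C => S w /\ exists d, 0 < d /\ forall v : C, Cmod (v - w) < d -> f v = g v).
set (B := fun w : C => S w /\ ~ A w).
assert (HA : is_open A).
{ intros w [Hw [d [Hd E']]]. destruct (HS w Hw) as [e [He HeS]].
  exists (Rmin d e / 2). assert (H1 := Rmin_l d e). assert (H2 := Rmin_r d e).
  assert (0 < Rmin d e) by (apply Rmin_glb_lt; assumption).
  split; [lra|]. intros v Hv. change (Cmod (v - w) < Rmin d e / 2) in Hv. split.
  - apply HeS. change (Cmod (v - w) < e). lra.
  - exists (d / 2); split; [lra|]. intros u Hu. apply E'.
    replace (u - w)%C with ((u - v) + (v - w))%C by ring.
    eapply Rle_lt_trans; [apply Cmod_triangle|]. lra. }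
(* If [v] within [e / 3] of [w] were in [A], then [f = g] on the disk of radius [2 / 3 * e] about
   [v], by [eq_on_disk]. That disk lies in [S] and contains the disk of radius [e / 3] about [w], so
   [w] would be in [A]. *)
assert (HB : is_open B).
{ intros w [Hw HnA]. destruct (HS w Hw) as [e [He HeS]].
  exists (e / 3); split; [lra|]. intros v Hv. change (Cmod (v - w) < e / 3) in Hv.
  assert (HvS : S v) by (apply HeS; change (Cmod (v - w) < e); lra).
  split; [exact HvS|]. intros [_ [d [Hd E']]]. apply HnA. split; [exact Hw|].
  exists (e / 3); split; [lra|]. intros u Hu.
  assert (Hin : forall x, Cmod (x - v) < 2 / 3 * e -> S x).
  { intros x Hx. apply HeS. change (Cmod (x - w) < e).
    replace (x - w)%C with ((x - v) + (v - w))%C by ring.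
    eapply Rle_lt_trans; [apply Cmod_triangle|]. lra. }
  apply (eq_on_disk f g v d (2 / 3 * e)); auto.
  replace (u - v)%C with ((u - w) + - (v - w))%C by ring.
  eapply Rle_lt_trans; [apply Cmod_triangle|]. rewrite Cmod_opp. lra. }
destruct (Hc A B HA HB) as [H|H].
- intro z; split.
  + intro Hz. destruct (classic (A z)); [left|right; split]; assumption.
  + intros [[Hz _]|[Hz _]]; exact Hz.
- intros z [H1 [_ H2]]; exact (H2 H1).
- exfalso. apply (H p). split; [exact Hp|]. exists r; auto.
- intros z Hz. destruct (NNPP (A z)) as [_ [d [Hd E']]].
  + intro HnA. apply (H z); split; assumption.
  + apply E'. replace (z - z)%C with (RtoC 0) by ring. rewrite Cmod_0; exact Hd.
Qed.

(** * Holomorphy of power series *)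

Definition cseries (b : nat -> C) : C := (Series (fun k => fst (b k)), Series (fun k => snd (b k))).

Definition abs_summable (b : nat -> C) : Prop := ex_series (fun k => Cmod (b k)).

Lemma abs_summable_ex b : abs_summable b ->
  ex_series (fun k => Rabs (fst (b k))) /\ ex_series (fun k => Rabs (snd (b k))).
Proof.
intro H; split; apply (ex_series_le (K := R_AbsRing) (V := R_CompleteNormedModule) _ _) with (2 := H);
intro n; change (norm ?x) with (Rabs x); rewrite Rabs_Rabsolu; [apply abs_fst_le|apply abs_snd_le].
Qed.

Lemma cseries_minus b c : abs_summable b -> abs_summable c ->
  cseries (fun k => b k - c k)%C = (cseries b - cseries c)%C.
Proof.
intros Hb Hc. destruct (abs_summable_ex b Hb), (abs_summable_ex c Hc).
unfold cseries, Cminus, Cplus, Copp; simpl.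
f_equal; apply Series_minus; apply ex_series_Rabs; assumption.
Qed.

Lemma cseries_scal x b : abs_summable b -> cseries (fun k => b k * x)%C = (cseries b * x)%C.
Proof.
intros Hb. destruct (abs_summable_ex b Hb) as [H1 H2].
apply ex_series_Rabs in H1, H2.
unfold cseries, Cmult; simpl. rewrite <- !Series_scal_r.
f_equal; [apply Series_minus|apply Series_plus]; apply (ex_series_scal_r); assumption.
Qed.

Lemma cseries_bound b (m : nat -> R) : ex_series m -> (forall k, Cmod (b k) <= m k) ->
  abs_summable b /\ Cmod (cseries b) <= 2 * Series m.
Proof.
intros Hm Hb.
assert (Hs : abs_summable b).
{ apply (ex_series_le (K := R_AbsRing) (V := R_CompleteNormedModule) _ m); [|exact Hm].
  intro n; change (norm ?x) with (Rabs x). rewrite Rabs_pos_eq by apply Cmod_ge_0. apply Hb. }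
split; [exact Hs|]. destruct (abs_summable_ex b Hs) as [H1 H2].
eapply Rle_trans; [apply Cmod_le_abs|]. unfold cseries; simpl.
assert (A1 : Rabs (Series (fun k => fst (b k))) <= Series m).
{ eapply Rle_trans; [apply Series_Rabs, H1|]. apply Series_le; [|exact Hm].
  intro n; split; [apply Rabs_pos|]. eapply Rle_trans; [apply abs_fst_le|apply Hb]. }
assert (A2 : Rabs (Series (fun k => snd (b k))) <= Series m).
{ eapply Rle_trans; [apply Series_Rabs, H2|]. apply Series_le; [|exact Hm].
  intro n; split; [apply Rabs_pos|]. eapply Rle_trans; [apply abs_snd_le|apply Hb]. }
lra.
Qed.

Lemma cseries_tail b n : abs_summable b ->
  cseries b = (csum b n + cseries (fun k => b (n + k)%nat))%C.
Proof.
intro Hb. induction n as [|n IH].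
- simpl. rewrite Cplus_0_l. reflexivity.
- rewrite IH. simpl. rewrite <- Cplus_assoc. f_equal.
  destruct (abs_summable_ex b Hb) as [H1 H2]. apply ex_series_Rabs in H1, H2.
  apply (ex_series_incr_n _ n) in H1. apply (ex_series_incr_n _ n) in H2.
  unfold cseries, Cplus; simpl. f_equal.
  + rewrite Series_incr_1 by exact H1. rewrite Nat.add_0_r. f_equal.
    apply Series_ext; intro k; rewrite Nat.add_succ_r; reflexivity.
  + rewrite Series_incr_1 by exact H2. rewrite Nat.add_0_r. f_equal.
    apply Series_ext; intro k; rewrite Nat.add_succ_r; reflexivity.
Qed.

(* [k z^(k-1)], by the product rule. *)
Fixpoint dpow (z : C) (k : nat) : C :=
  match k with O => RtoC 0 | S k => (z * dpow z k + z ^ k)%C end.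

Section PowerEstimates.
Variables (z w : C) (r : R).
Hypotheses (Hr : 0 < r) (Hz : Cmod z <= r) (Hw : Cmod w <= r).

Lemma Cmod_pow_le v k : Cmod v <= r -> Cmod (v ^ k)%C <= r ^ k.
Proof. intro Hv. rewrite Cmod_pow. apply pow_incr; split; [apply Cmod_ge_0|exact Hv]. Qed.

(** The factor [r] on the left, and [r * r] in [pow_taylor_bound], keep the exponent equal to [k]
    where [k - 1] or [k - 2] would be natural. *)
Lemma dpow_bound k : Cmod (dpow z k) * r <= INR k * r ^ k.
Proof.
induction k as [|k IH].
- simpl. rewrite Cmod_0; lra.
- rewrite S_INR. cbn [dpow pow].
  apply Rle_trans with ((Cmod z * Cmod (dpow z k) + r ^ k) * r).
  + apply Rmult_le_compat_r; [lra|]. eapply Rle_trans; [apply Cmod_triangle|].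
    rewrite Cmod_mult. apply Rplus_le_compat_l, Cmod_pow_le, Hz.
  + assert (Cmod z * (Cmod (dpow z k) * r) <= r * (INR k * r ^ k)); [|lra].
    apply Rmult_le_compat; trivial; [apply Cmod_ge_0|].
    apply Rmult_le_pos; [apply Cmod_ge_0|lra].
Qed.

Lemma pow_diff_bound k : Cmod (w ^ k - z ^ k)%C * r <= INR k * r ^ k * Cmod (w - z).
Proof.
induction k as [|k IH].
- simpl. replace (1 - 1)%C with (RtoC 0) by ring. rewrite Cmod_0; lra.
- rewrite S_INR. cbn [pow Cpow].
  replace (w * w ^ k - z * z ^ k)%C with (z * (w ^ k - z ^ k) + (w - z) * w ^ k)%C by ring.
  apply Rle_trans with ((Cmod z * Cmod (w ^ k - z ^ k)%C + Cmod (w - z) * r ^ k) * r).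
  + apply Rmult_le_compat_r; [lra|]. eapply Rle_trans; [apply Cmod_triangle|].
    rewrite !Cmod_mult. apply Rplus_le_compat_l, Rmult_le_compat_l; [apply Cmod_ge_0|].
    apply Cmod_pow_le, Hw.
  + assert (Cmod z * (Cmod (w ^ k - z ^ k)%C * r) <= r * (INR k * r ^ k * Cmod (w - z))); [|lra].
    apply Rmult_le_compat; trivial; [apply Cmod_ge_0|].
    apply Rmult_le_pos; [apply Cmod_ge_0|lra].
Qed.

Lemma pow_taylor_bound k :
  Cmod (w ^ k - z ^ k - dpow z k * (w - z))%C * (r * r) <=
  INR k * INR k * r ^ k * (Cmod (w - z) * Cmod (w - z)).
Proof.
induction k as [|k IH].
- simpl. replace (1 - 1 - 0 * (w - z))%C with (RtoC 0) by ring. rewrite Cmod_0; lra.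
- assert (D := pow_diff_bound k). rewrite S_INR. cbn [pow Cpow dpow].
  replace (w * w ^ k - z * z ^ k - (z * dpow z k + z ^ k) * (w - z))%C
    with (z * (w ^ k - z ^ k - dpow z k * (w - z)) + (w - z) * (w ^ k - z ^ k))%C by ring.
  set (e := Cmod (w ^ k - z ^ k - dpow z k * (w - z))%C) in *.
  set (h := Cmod (w - z)) in *. set (d := Cmod (w ^ k - z ^ k)%C) in *.
  assert (He : 0 <= e) by apply Cmod_ge_0. assert (Hh : 0 <= h) by apply Cmod_ge_0.
  assert (Hk := pos_INR k). assert (Hrk : 0 <= r ^ k) by (apply pow_le; lra).
  apply Rle_trans with ((Cmod z * e + h * d) * (r * r)).
  + apply Rmult_le_compat_r; [nra|]. eapply Rle_trans; [apply Cmod_triangle|].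
    rewrite !Cmod_mult. right; reflexivity.
  + assert (T1 : Cmod z * (e * (r * r)) <= r * (INR k * INR k * r ^ k * (h * h))).
    { apply Rmult_le_compat; trivial; [apply Cmod_ge_0|]. apply Rmult_le_pos; nra. }
    assert (T2 : (h * r) * (d * r) <= (h * r) * (INR k * r ^ k * h)).
    { apply Rmult_le_compat_l; [nra|exact D]. }
    assert (T3 : 0 <= (INR k + 1) * (r * r ^ k) * (h * h)).
    { apply Rmult_le_pos; [|nra]. apply Rmult_le_pos; [lra|nra]. }
    nra.
Qed.
End PowerEstimates.

(* With [p^4 = q], Bernoulli's inequality bounds [k p^k], and [k^2 q^k = (k p^k)^2 (p^2)^k]. *)
Lemma ex_series_sqr_geometric q : 0 < q < 1 -> ex_series (fun k => INR k * INR k * q ^ k).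
Proof.
intro Hq.
set (p := sqrt (sqrt q)).
assert (Hs : 0 < sqrt q) by (apply sqrt_lt_R0; lra).
assert (Hs2 : sqrt q * sqrt q = q) by (apply sqrt_sqrt; lra).
assert (Hp : 0 < p) by (apply sqrt_lt_R0; lra).
assert (Hp2 : p * p = sqrt q) by (apply sqrt_sqrt; lra).
assert (Hs1 : sqrt q < 1) by nra.
assert (Hp1 : p < 1) by nra.
set (x := / p - 1).
assert (Hx : 0 < x).
{ unfold x. assert (1 < / p); [|lra]. rewrite <- Rinv_1. apply Rinv_lt_contravar; lra. }
assert (Hk : forall k, 0 <= INR k * p ^ k <= / x).
{ intro k. assert (Hpk : 0 < p ^ k) by (apply pow_lt, Hp). split.
  - apply Rmult_le_pos; [apply pos_INR|lra].
  - assert (H := poly k x Hx). replace (1 + x) with (/ p) in H by (unfold x; ring).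
    rewrite pow_inv in H.
    apply Rmult_le_reg_l with x; [exact Hx|]. rewrite Rinv_r by lra.
    apply Rle_trans with ((/ p ^ k) * p ^ k); [|right; field; lra].
    replace (x * (INR k * p ^ k)) with ((INR k * x) * p ^ k) by ring.
    apply Rmult_le_compat_r; lra. }
apply (ex_series_le (K := R_AbsRing) (V := R_CompleteNormedModule) _
  (fun k => (/ x * / x) * (sqrt q) ^ k)).
- intro k. change (norm ?y) with (Rabs y).
  assert (E : INR k * INR k * q ^ k = (INR k * p ^ k) * (INR k * p ^ k) * sqrt q ^ k).
  { rewrite <- Hs2 at 1. rewrite <- Hp2 at 1. rewrite !Rpow_mult_distr. ring. }
  assert (0 < sqrt q ^ k) by (apply pow_lt, Hs). specialize (Hk k).
  rewrite E, Rabs_pos_eq by (apply Rmult_le_pos; nra).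
  apply Rmult_le_compat_r; [lra|]. apply Rmult_le_compat; lra.
- apply (ex_series_scal_l (K := R_AbsRing) (V := R_NormedModule)). apply ex_series_geom. rewrite Rabs_pos_eq; lra.
Qed.

Section PowerSeries.
Variables (c : nat -> C) (a : C) (rho M : R).
Hypotheses (Hrho : 0 < rho) (Hc : forall k, Cmod (c k) * rho ^ k <= M).

Definition power_series (z : C) : C := cseries (fun k => c k * (z - a) ^ k)%C.

Let HM : 0 <= M.
Proof.
eapply Rle_trans; [|apply (Hc 0)]. simpl. rewrite Rmult_1_r. apply Cmod_ge_0.
Qed.

(** [Hc] absorbs [rho ^ k] after writing [r = rho * (r / rho)]. In the uses, [x] is 1 or [k^2], and
    [y] does not depend on [k]. *)
Let term_bound k x r y : 0 <= r -> 0 <= y -> 0 <= x ->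
  Cmod (c k) * (y * (x * r ^ k)) <= y * M * (x * (r / rho) ^ k).
Proof.
intros Hr Hy Hx.
assert (Hp : 0 < rho ^ k) by (apply pow_lt, Hrho).
unfold Rdiv. rewrite Rpow_mult_distr, pow_inv.
assert (0 <= r ^ k) by (apply pow_le, Hr).
replace (Cmod (c k) * (y * (x * r ^ k))) with ((Cmod (c k) * rho ^ k) * (y * (x * (r ^ k * / rho ^ k))))
  by (field; lra).
replace (y * M * (x * (r ^ k * / rho ^ k))) with (M * (y * (x * (r ^ k * / rho ^ k)))) by ring.
apply Rmult_le_compat_r; [|apply Hc].
repeat apply Rmult_le_pos; trivial. left; apply Rinv_0_lt_compat, Hp.
Qed.

Let summable_of_bound (b : nat -> C) r x : 0 < r < rho -> 0 <= x ->
  (forall k, Cmod (b k) <= x * ((INR k * INR k) * r ^ k) \/ Cmod (b k) <= x * r ^ k) ->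
  abs_summable (fun k => c k * b k)%C.
Proof.
intros Hr Hx Hb.
assert (Hq : 0 < r / rho < 1).
{ split; [apply Rdiv_lt_0_compat; lra|]. apply Rlt_div_l; lra. }
apply (cseries_bound _ (fun k => x * M * ((INR k * INR k) * (r / rho) ^ k) + x * M * (1 * (r / rho) ^ k))).
- apply (ex_series_plus (K := R_AbsRing) (V := R_NormedModule)).
  + apply (ex_series_scal_l (K := R_AbsRing) (V := R_NormedModule)), ex_series_sqr_geometric, Hq.
  + apply (ex_series_scal_l (K := R_AbsRing) (V := R_NormedModule)), (ex_series_scal_l (K := R_AbsRing) (V := R_NormedModule)).
    apply ex_series_geom. rewrite Rabs_pos_eq; lra.
- intro k. rewrite Cmod_mult.
  assert (Hkk : 0 <= INR k * INR k) by (apply Rmult_le_pos; apply pos_INR).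
  assert (Hq' : 0 <= (r / rho) ^ k) by (apply pow_le; lra).
  assert (P1 : 0 <= x * M * ((INR k * INR k) * (r / rho) ^ k)) by (apply Rmult_le_pos; apply Rmult_le_pos; lra).
  assert (P2 : 0 <= x * M * (1 * (r / rho) ^ k)) by (apply Rmult_le_pos; apply Rmult_le_pos; lra).
  destruct (Hb k) as [H|H];
  apply (fun H => Rmult_le_compat_l _ _ _ (Cmod_ge_0 (c k)) H) in H.
  + generalize (term_bound k (INR k * INR k) r x ltac:(lra) Hx Hkk); lra.
  + generalize (term_bound k 1 r x ltac:(lra) Hx Rle_0_1); lra.
Qed.

Lemma power_series_summable z : Cmod (z - a) < rho -> abs_summable (fun k => c k * (z - a) ^ k)%C.
Proof.
intro Hz. assert (H0 := Cmod_ge_0 (z - a)).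
(* The midpoint, since a positive radius is required and [z] may equal [a]. *)
apply (summable_of_bound _ ((Cmod (z - a) + rho) / 2) 1); [lra|lra|].
intro k. right. rewrite Rmult_1_l. apply Cmod_pow_le. lra.
Qed.

Lemma power_series_remainder z n : Cmod (z - a) < rho ->
  Cmod (power_series z - csum (fun k => c k * (z - a) ^ k)%C n) <=
  2 * M / (1 - Cmod (z - a) / rho) * (Cmod (z - a) / rho) ^ n.
Proof.
intro Hz. assert (H0 := Cmod_ge_0 (z - a)).
set (q := Cmod (z - a) / rho).
assert (Hq : 0 <= q < 1).
{ split; [apply Rdiv_le_0_compat; lra|]. apply Rlt_div_l; lra. }
unfold power_series. rewrite (cseries_tail _ n) by apply power_series_summable, Hz.
match goal with |- Cmod (?A + ?B - ?A)%C <= _ => replace (A + B - A)%C with B by ring end.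
destruct (cseries_bound (fun k => c (n + k)%nat * (z - a) ^ (n + k))%C
  (fun k => M * q ^ n * q ^ k)) as [_ H].
- apply (ex_series_scal_l (K := R_AbsRing) (V := R_NormedModule)), ex_series_geom. rewrite Rabs_pos_eq; lra.
- intro k. rewrite Cmod_mult, Cmod_pow.
  assert (T := term_bound (n + k) 1 (Cmod (z - a)) 1 H0 Rle_0_1 Rle_0_1).
  fold q in T. rewrite (pow_add q) in T. lra.
- eapply Rle_trans; [exact H|]. rewrite Series_scal_l, Series_geom by (rewrite Rabs_pos_eq; lra).
  right; field; lra.
Qed.

(** Termwise differentiation: by [pow_taylor_bound], the second-order remainders of the powers sum
    to at most [B * Cmod (w - z)^2]. *)
Lemma cdiff_power_series z : Cmod (z - a) < rho -> cdiff power_series z.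
Proof.
intro Hz. assert (H0 := Cmod_ge_0 (z - a)).
set (r := (Cmod (z - a) + rho) / 2).
assert (Hr : 0 < r < rho) by (unfold r; lra).
assert (Hq : 0 < r / rho < 1).
{ split; [apply Rdiv_lt_0_compat; lra|]. apply Rlt_div_l; lra. }
assert (Hzr : Cmod (z - a) <= r) by (unfold r; lra).
assert (Sd : abs_summable (fun k => c k * dpow (z - a) k)%C).
{ apply (summable_of_bound _ r (/ r)); [exact Hr|left; apply Rinv_0_lt_compat; lra|].
  intro k. left.
  assert (D := dpow_bound (z - a) r ltac:(lra) Hzr k).
  apply Rmult_le_reg_r with r; [lra|]. eapply Rle_trans; [exact D|].
  replace (/ r * (INR k * INR k * r ^ k) * r) with (INR k * INR k * r ^ k) by (field; lra).
  apply Rmult_le_compat_r; [apply pow_le; lra|].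
  destruct k; [simpl; lra|]. assert (1 <= INR (S k)) by (rewrite S_INR; generalize (pos_INR k); lra). nra. }
set (T := Series (fun k => INR k * INR k * (r / rho) ^ k)).
exists (cseries (fun k => c k * dpow (z - a) k)%C).
intros eps He.
set (B := 2 * (M / (r * r) * T)).
(* Read off from [cseries_bound] for the zero sequence, which [T] dominates. *)
assert (HT : 0 <= T).
{ assert (H := proj2 (cseries_bound (fun _ => 0%C) _ (ex_series_sqr_geometric _ Hq)
    (fun k => ltac:(cbv beta; rewrite Cmod_0; repeat apply Rmult_le_pos; try apply pos_INR; apply pow_le; lra)))).
  generalize (Cmod_ge_0 (cseries (fun _ => 0%C))). fold T in H. lra. }
assert (HB : 0 <= B).
{ unfold B. apply Rmult_le_pos; [lra|]. apply Rmult_le_pos; [|exact HT].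
  apply Rdiv_le_0_compat; nra. }
exists (Rmin (r - Cmod (z - a)) (eps / (B + 1))); split.
{ apply Rmin_glb_lt; [unfold r; lra|]. apply Rdiv_lt_0_compat; lra. }
intros w Hw.
assert (Hw1 := Rlt_le_trans _ _ _ Hw (Rmin_l _ _)).
assert (Hw2 := Rlt_le_trans _ _ _ Hw (Rmin_r _ _)).
assert (Hwr : Cmod (w - a) <= r).
{ replace (w - a)%C with ((w - z) + (z - a))%C by ring.
  eapply Rle_trans; [apply Cmod_triangle|]. lra. }
assert (E : (power_series w - power_series z - cseries (fun k => c k * dpow (z - a) k) * (w - z))%C =
  cseries (fun k => c k * ((w - a) ^ k - (z - a) ^ k - dpow (z - a) k * ((w - a) - (z - a))))%C).
{ unfold power_series.
  rewrite <- cseries_scal by exact Sd.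
  assert (S1 := power_series_summable w ltac:(lra)). assert (S2 := power_series_summable z Hz).
  rewrite <- cseries_minus by assumption.
  rewrite <- cseries_minus.
  - unfold cseries; f_equal; apply Series_ext; intro k; f_equal; ring.
  - unfold abs_summable.
    apply (ex_series_le (K := R_AbsRing) (V := R_CompleteNormedModule) _
      (fun k => Cmod (c k * (w - a) ^ k)%C + Cmod (c k * (z - a) ^ k)%C)).
    + intro k. change (norm ?y) with (Rabs y). rewrite Rabs_pos_eq by apply Cmod_ge_0.
      unfold Cminus at 1. rewrite <- (Cmod_opp (c k * (z - a) ^ k)). apply Cmod_triangle.
    + apply (ex_series_plus (K := R_AbsRing) (V := R_NormedModule)); assumption.
  - unfold abs_summable. apply ex_series_ext with (fun k => Cmod (c k * dpow (z - a) k)%C * Cmod (w - z)).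
    + intro k. symmetry. apply Cmod_mult.
    + apply (ex_series_scal_r). exact Sd. }
rewrite E.
set (h := Cmod (w - z)) in *. assert (Hh : 0 <= h) by apply Cmod_ge_0.
apply Rlt_div_r in Hw2; [|lra].
apply Rle_trans with (2 * (h * h / (r * r) * M * T)).
- unfold T. rewrite <- Series_scal_l. apply cseries_bound.
  + apply (ex_series_scal_l (K := R_AbsRing) (V := R_NormedModule)), ex_series_sqr_geometric, Hq.
  + intro k. rewrite Cmod_mult.
    assert (D := pow_taylor_bound (z - a) (w - a) r ltac:(lra) Hzr Hwr k).
    replace (w - a - (z - a))%C with (w - z)%C in * by ring. fold h in D.
    assert (Hhr : 0 <= h * h / (r * r)) by (apply Rdiv_le_0_compat; nra).
    assert (Hkk : 0 <= INR k * INR k) by (apply Rmult_le_pos; apply pos_INR).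
    assert (P := term_bound k (INR k * INR k) r (h * h / (r * r)) ltac:(lra) Hhr Hkk).
    eapply Rle_trans; [|exact P]. apply Rmult_le_compat_l; [apply Cmod_ge_0|].
    apply Rmult_le_reg_r with (r * r); [nra|]. eapply Rle_trans; [exact D|].
    right; field; lra.
- replace (2 * (h * h / (r * r) * M * T)) with (B * h * h) by (unfold B; field; lra).
  apply Rmult_le_compat_r; [exact Hh|]. lra.
Qed.
End PowerSeries.

(** * Extendability at a boundary point *)

Lemma cdiff_of_holomorphic U f z : is_open U -> holomorphic_on U f -> U z -> cdiff f z.
Proof.
intros HU Hf Hz. destruct (HU z Hz) as [r [Hr HrU]]. destruct (Hf z Hz) as [l Hl].
exists l. intros eps He. destruct (Hl eps He) as [d [Hd Hd']].
exists (Rmin d r); split; [apply Rmin_glb_lt; assumption|]. intros w Hw.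
apply Hd'.
- apply HrU. exact (Rlt_le_trans _ _ _ Hw (Rmin_r _ _)).
- exact (Rlt_le_trans _ _ _ Hw (Rmin_l _ _)).
Qed.

Lemma holomorphic_of_cdiff (U : Cplx -> Prop) f :
  (forall z, U z -> cdiff f z) -> holomorphic_on U f.
Proof.
intros Hf z Hz. destruct (Hf z Hz) as [l Hl]. exists l. intros eps He.
destruct (Hl eps He) as [d [Hd Hd']]. exists d; split; [exact Hd|].
intros w _ Hw. exact (Hd' w Hw).
Qed.

Lemma cdiff_plus f g z : cdiff f z -> cdiff g z -> cdiff (fun w => f w + g w)%C z.
Proof.
intros [l Hl] [m Hm]. exists (l + m)%C. intros eps He.
destruct (Hl (eps / 2)) as [d1 [Hd1 H1]]; [lra|].
destruct (Hm (eps / 2)) as [d2 [Hd2 H2]]; [lra|].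
exists (Rmin d1 d2); split; [apply Rmin_glb_lt; assumption|]. intros w Hw.
specialize (H1 w (Rlt_le_trans _ _ _ Hw (Rmin_l _ _))).
specialize (H2 w (Rlt_le_trans _ _ _ Hw (Rmin_r _ _))).
replace (f w + g w - (f z + g z) - (l + m) * (w - z))%C
  with ((f w - f z - l * (w - z)) + (g w - g z - m * (w - z)))%C by ring.
eapply Rle_trans; [apply Cmod_triangle|]. lra.
Qed.

Lemma is_open_disk z0 r : is_open (disk z0 r).
Proof.
intros z Hz. change (Cmod (z - z0) < r) in Hz. exists (r - Cmod (z - z0)); split; [lra|].
intros w Hw. change (Cmod (w - z) < r - Cmod (z - z0)) in Hw. change (Cmod (w - z0) < r).
replace (w - z0)%C with ((w - z) + (z - z0))%C by ring.
eapply Rle_lt_trans; [apply Cmod_triangle|]. lra.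
Qed.

Lemma is_open_inter (U V : Cplx -> Prop) : is_open U -> is_open V -> is_open (fun z => U z /\ V z).
Proof.
intros HU HV z [Hz1 Hz2].
destruct (HU z Hz1) as [r1 [Hr1 H1]]. destruct (HV z Hz2) as [r2 [Hr2 H2]].
exists (Rmin r1 r2); split; [apply Rmin_glb_lt; assumption|].
intros w Hw; split; [apply H1|apply H2].
- exact (Rlt_le_trans _ _ _ Hw (Rmin_l _ _)).
- exact (Rlt_le_trans _ _ _ Hw (Rmin_r _ _)).
Qed.

(** Halving of the parameter interval: near each parameter a single member of the cover suffices,
    and finite subcovers of two halves concatenate. *)
Lemma compact_circle a s : compact (fun z => exists t, 0 <= t <= 1 /\ z = circle a s t).
Proof.
intros I U HU Hcov.
destruct (square_induction (fun _ y l => exists li : list I,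
  forall t, y <= t <= y + l -> exists i, In i li /\ U i (circle a s t))) as [li Hli].
- intros x y l _ _ _ _ _ [l1 H1] _ [l2 H2] _. exists (l1 ++ l2). intros t Ht.
  destruct (Rle_dec t (y + l / 2)).
  + destruct (H1 t) as [i [Hi Hi']]; [lra|]. exists i; split; [|exact Hi'].
    apply in_or_app; left; exact Hi.
  + destruct (H2 t) as [i [Hi Hi']]; [lra|]. exists i; split; [|exact Hi'].
    apply in_or_app; right; exact Hi.
- intros u v _ Hv. destruct (Hcov (circle a s v)) as [i Hi]; [exists v; auto|].
  destruct (HU i _ Hi) as [r [Hr Hr']].
  destruct (proj1 (ccont_eps _ v) (ccont_circle a s v) r Hr) as [d [Hd Hd']].
  exists d; split; [exact Hd|]. intros x y l Hl _ _ _ _ _ Hy.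
  exists (i :: nil). intros t Ht. exists i; split; [left; reflexivity|].
  apply Hr'. apply Hd', Rabs_lt_between'; lra.
- exists li. intros z [t [Ht ->]]. apply Hli; lra.
Qed.

(** The sets [Cmod (z - z0) > 1 / (n + 1)] cover [K] and increase with [n], so the largest index of
    a finite subcover gives [m]. *)
Lemma compact_distance K z0 : compact K -> ~ K z0 ->
  exists m, 0 < m /\ forall z : C, K z -> m <= Cmod (z - z0).
Proof.
intros HK Hz0.
destruct (HK nat (fun n z => / (INR n + 1) < Cnorm (Csub z z0))) as [l Hl].
- intros n z Hz. change (/ (INR n + 1) < Cmod (z - z0)) in Hz.
  exists (Cmod (z - z0) - / (INR n + 1)); split; [lra|]. intros w Hw.
  change (Cmod (w - z) < Cmod (z - z0) - / (INR n + 1)) in Hw.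
  change (/ (INR n + 1) < Cmod (w - z0)).
  assert (Cmod (z - z0) <= Cmod (w - z0) + Cmod (w - z)); [|lra].
  replace (z - z0)%C with ((w - z0) + - (w - z))%C by ring.
  eapply Rle_trans; [apply Cmod_triangle|]. rewrite Cmod_opp; lra.
- intros z Hz.
  assert (H0 : 0 < Cmod (z - z0)).
  { apply Cmod_gt_0. intro E. apply Hz0. rewrite <- (Cminus_eq_0 z z0 E). exact Hz. }
  destruct (archimed_cor1 _ H0) as [N [HN HN']]. exists N.
  change (/ (INR N + 1) < Cmod (z - z0)). eapply Rlt_trans; [|exact HN].
  apply Rinv_lt_contravar; [|lra]. apply lt_0_INR in HN'. apply Rmult_lt_0_compat; lra.
- exists (/ (INR (list_max l) + 1)). assert (Hp := pos_INR (list_max l)).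
  split; [apply Rinv_0_lt_compat; lra|]. intros z Hz.
  destruct (Hl z Hz) as [n [Hn Hn']]. apply Rle_trans with (/ (INR n + 1)); [|left; exact Hn'].
  assert (Hm := proj1 (Forall_forall _ _) (proj1 (list_max_le l (list_max l)) (le_n _)) n Hn).
  apply le_INR in Hm. assert (H := pos_INR n). apply Rinv_le_contravar; lra.
Qed.

(** A single coefficient exceeding the bound persists when [f] is perturbed uniformly on the circle,
    which is a compact subset of [O]. *)
Lemma H_open_coef O a s rho x : is_open O -> 0 < s -> 0 < rho ->
  (forall w : C, Cmod (w - a) <= s -> O w) ->
  H_open O (fun f => exists k, x < Cmod (coef f a s k) * rho ^ k).
Proof.
intros HO Hs Hrho Hin f Hf [k Hk].
set (gap := Cmod (coef f a s k) * rho ^ k - x) in *.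
assert (Hgap : 0 < gap) by (unfold gap; lra).
assert (Hrk : 0 < rho ^ k) by (apply pow_lt, Hrho).
assert (Hsk : 0 < (/ s) ^ k) by (apply pow_lt, Rinv_0_lt_compat, Hs).
(* Makes [2 * (eps * (/ s) ^ k) * rho ^ k] equal to [gap / 2]. *)
set (eps := gap / (4 * ((/ s) ^ k * rho ^ k))).
assert (He : 0 < eps).
{ apply Rdiv_lt_0_compat; [exact Hgap|]. apply Rmult_lt_0_compat; [lra|].
  apply Rmult_lt_0_compat; assumption. }
exists (fun z => exists t, 0 <= t <= 1 /\ z = circle a s t), eps.
split; [apply compact_circle|]. split.
{ intros z [t [_ ->]]. apply Hin. rewrite Cmod_circle; lra. }
split; [exact He|]. intros g Hg Hgf. exists k.
assert (Cf : forall w, Cmod (w - a) = s -> cdiff f w).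
{ intros w Hw; apply (cdiff_of_holomorphic O); trivial. apply Hin; lra. }
assert (Cg : forall w, Cmod (w - a) = s -> cdiff g w).
{ intros w Hw; apply (cdiff_of_holomorphic O); trivial. apply Hin; lra. }
assert (Hd : Cmod (coef g a s k - coef f a s k) <= 2 * (1 - 0) * (eps * (/ s) ^ k)).
{ unfold coef. rewrite <- cint_minus;
    [|lra|intros; apply ccont_coef_integrand; assumption..].
  apply cint_bound; [lra|..].
  - intros; apply ccont_minus; apply ccont_coef_integrand; assumption.
  - intros t Ht.
    replace (g (circle a s t) * (/ (s * cis t)) ^ k - f (circle a s t) * (/ (s * cis t)) ^ k)%C
      with ((g (circle a s t) - f (circle a s t)) * (/ (s * cis t)) ^ k)%C by ring.
    rewrite Cmod_mult, Cmod_scis_inv_pow by exact Hs.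
    apply Rmult_le_compat_r; [lra|]. left. apply (Hgf (circle a s t)). exists t; auto. }
assert (Hd' : Cmod (coef g a s k - coef f a s k) * rho ^ k <= gap / 2).
{ apply Rle_trans with (2 * (1 - 0) * (eps * (/ s) ^ k) * rho ^ k).
  - apply Rmult_le_compat_r; lra.
  - right. unfold eps. field. split; lra. }
assert (Ht : Cmod (coef f a s k) <= Cmod (coef g a s k) + Cmod (coef g a s k - coef f a s k)).
{ replace (coef f a s k) with (coef g a s k + - (coef g a s k - coef f a s k))%C at 1 by ring.
  eapply Rle_trans; [apply Cmod_triangle|]. rewrite Cmod_opp; lra. }
apply (Rmult_le_compat_r (rho ^ k)) in Ht; [|lra]. unfold gap in *. lra.
Qed.

(** The property negated in [U1]. *)
Definition extends_at (O : Cplx -> Prop) (z0 : Cplx) (f : Cplx -> Cplx) : Prop :=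
  exists r (F : Cplx -> Cplx), 0 < r /\ holomorphic_on (disk z0 r) F /\
    forall z, O z -> disk z0 r z -> F z = f z.

Lemma disk_radius_le O (z0 a : C) s : ~ O z0 -> (forall w : C, Cmod (w - a) <= s -> O w) ->
  s < Cmod (a - z0).
Proof.
intros Hz0 Hin. destruct (Rlt_le_dec s (Cmod (a - z0))) as [H|H]; [exact H|].
exfalso. apply Hz0, Hin. replace (z0 - a)%C with (- (a - z0))%C by ring. rewrite Cmod_opp; exact H.
Qed.

Lemma extends_of_coef_bound O (z0 a : C) s M f : is_open O -> ~ O z0 -> holomorphic_on O f ->
  0 < s -> (forall w : C, Cmod (w - a) <= s -> O w) ->
  open_connected (fun z => disk z0 (2 * Cmod (a - z0)) z /\ O z) ->
  (forall k, Cmod (coef f a s k) * (3 * Cmod (a - z0)) ^ k <= M) ->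
  extends_at O z0 f.
Proof.
intros HO Hz0 Hf Hs Hin Hconn Hc.
assert (Hsd := disk_radius_le O z0 a s Hz0 Hin).
set (d := Cmod (a - z0)) in *.
set (F := power_series (coef f a s) a).
assert (HF : forall z, Cmod (z - z0) < 2 * d -> cdiff F z).
{ intros z Hz. apply (cdiff_power_series _ a (3 * d) M); [lra|exact Hc|].
  replace (z - a)%C with ((z - z0) + - (a - z0))%C by ring.
  eapply Rle_lt_trans; [apply Cmod_triangle|]. rewrite Cmod_opp. fold d; lra. }
assert (Cf : forall z, O z -> cdiff f z) by (intros z Hz; apply (cdiff_of_holomorphic O); assumption).
exists (2 * d), F. split; [lra|]. split; [apply holomorphic_of_cdiff, HF|].
intros z Hz Hzd.
apply (identity_theorem F f (fun z => disk z0 (2 * d) z /\ O z) a s).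
- apply is_open_inter; [apply is_open_disk|exact HO].
- exact Hconn.
- intros w [Hw _]. apply HF, Hw.
- intros w [_ Hw]. apply Cf, Hw.
- split.
  + change (Cmod (a - z0) < 2 * d). fold d. lra.
  + apply Hin. replace (a - a)%C with (RtoC 0) by ring. rewrite Cmod_0; lra.
- exact Hs.
(* On [D (a, s)] both functions are approximated by the same partial sums. As [s < d], the ratio for
   the radius [3 * d] is at most the one for [s], so one geometric rate serves both. *)
- intros w Hw. assert (H0 := Cmod_ge_0 (w - a)).
  destruct (taylor f a s w Hw) as [B HB]; [intros; apply Cf, Hin; assumption|].
  assert (HR := fun n => power_series_remainder (coef f a s) a (3 * d) M ltac:(lra) Hc w n ltac:(lra)).
  set (B' := 2 * M / (1 - Cmod (w - a) / (3 * d))) in *.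
  assert (Hq : 0 <= Cmod (w - a) / s < 1).
  { split; [apply Rdiv_le_0_compat; lra|]. apply Rlt_div_l; lra. }
  apply (eq_of_geometric_bound _ _ (fun n => csum (fun k => coef f a s k * (w - a) ^ k)%C n)
    (Rabs B' + Rabs B) (Cmod (w - a) / s) Hq); intro n.
  + eapply Rle_trans; [apply HR|].
    assert (Hq' : 0 <= Cmod (w - a) / (3 * d) <= Cmod (w - a) / s).
    { split; [apply Rdiv_le_0_compat; lra|]. apply Rmult_le_compat_l; [exact H0|].
      apply Rinv_le_contravar; lra. }
    assert (Hp := pow_incr _ _ n Hq').
    assert (Hp0 : 0 <= (Cmod (w - a) / (3 * d)) ^ n) by (apply pow_le; lra).
    apply Rle_trans with (Rabs B' * (Cmod (w - a) / (3 * d)) ^ n).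
    * apply Rmult_le_compat_r; [exact Hp0|apply Rle_abs].
    * apply Rmult_le_compat; trivial; [apply Rabs_pos|]. generalize (Rabs_pos B); lra.
  + eapply Rle_trans; [apply HB|].
    apply Rmult_le_compat_r; [apply pow_le; lra|].
    generalize (Rle_abs B) (Rabs_pos B'); lra.
- split; assumption.
Qed.

(** On the circle of radius [s] the functions [f] and [F] agree; the coefficients of [F] may be
    moved to the radius [3 * d], still inside [disk z0 r], where Cauchy's estimate applies. *)
Lemma coef_bound_of_extends O (z0 a : C) s r f F : is_open O -> ~ O z0 -> holomorphic_on O f ->
  0 < s -> (forall w : C, Cmod (w - a) <= s -> O w) ->
  holomorphic_on (disk z0 r) F -> (forall z, O z -> disk z0 r z -> F z = f z) ->
  4 * Cmod (a - z0) < r ->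
  exists M, forall k, Cmod (coef f a s k) * (3 * Cmod (a - z0)) ^ k <= M.
Proof.
intros HO Hz0 Hf Hs Hin HF E Hr.
assert (Hsd := disk_radius_le O z0 a s Hz0 Hin).
set (d := Cmod (a - z0)) in *.
assert (Hdisk : forall w, Cmod (w - a) <= 3 * d -> disk z0 r w).
{ intros w Hw. change (Cmod (w - z0) < r).
  replace (w - z0)%C with ((w - a) + (a - z0))%C by ring.
  eapply Rle_lt_trans; [apply Cmod_triangle|]. fold d; lra. }
assert (CF : forall w, Cmod (w - a) <= 3 * d -> cdiff F w).
{ intros w Hw. apply (cdiff_of_holomorphic (disk z0 r)); auto. apply is_open_disk. }
destruct (ccont_bounded (fun t => F (circle a (3 * d) t))) as [M [HM HM']].
{ intros t _. apply (ccont_comp F (circle a (3 * d))); [apply ccont_circle|].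
  apply CF. rewrite Cmod_circle; lra. }
exists (2 * M). intro k.
rewrite (coef_ext f F).
- rewrite (coef_radius F a s (3 * d)) by (try (intros; apply CF); lra).
  assert (B := coef_bound F a (3 * d) k M ltac:(lra) (fun w Hw => CF w (Req_le _ _ Hw)) HM').
  assert (Hp : 0 < (3 * d) ^ k) by (apply pow_lt; lra).
  apply (Rmult_le_compat_r ((3 * d) ^ k)) in B; [|lra].
  eapply Rle_trans; [exact B|]. rewrite pow_inv. right; field; lra.
- intro t. symmetry. assert (H : Cmod (circle a s t - a) = s) by (apply Cmod_circle; lra).
  apply E; [apply Hin|apply Hdisk]; lra.
Qed.

(** * The countable intersection and density *)

Lemma H_Gdelta_U1 O z0 delta : is_open O -> boundary_point O z0 -> 0 < delta ->
  (forall r, 0 < r -> r <= delta -> open_connected (fun z => disk z0 r z /\ O z)) ->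
  H_Gdelta O (U1 O z0).
Proof.
intros HO [Hz0 Hbd] Hdelta Hconn.
assert (Hex : forall n : nat, exists p : C * R,
  Cmod (fst p - z0) < / (INR n + 1) /\ Cmod (fst p - z0) < delta / 2 /\
  0 < snd p /\ forall w : C, Cmod (w - fst p) <= snd p -> O w).
{ intro n. assert (Hn : 0 < / (INR n + 1)) by (apply Rinv_0_lt_compat; generalize (pos_INR n); lra).
  (* [delta / 2] ensures that the connectedness hypothesis covers the radius [2 * Cmod (a - z0)]. *)
  destruct (Hbd (Rmin (/ (INR n + 1)) (delta / 2))) as [a [Ha HaO]]; [apply Rmin_glb_lt; lra|].
  destruct (HO a HaO) as [s [Hs HsO]].
  exists (a, s / 2); simpl. split; [exact (Rlt_le_trans _ _ _ Ha (Rmin_l _ _))|].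
  split; [exact (Rlt_le_trans _ _ _ Ha (Rmin_r _ _))|]. split; [lra|].
  intros w Hw. apply HsO. change (Cmod (w - a) < s). lra. }
set (a := fun n => fst (proj1_sig (constructive_indefinite_description _ (Hex n)))).
set (s := fun n => snd (proj1_sig (constructive_indefinite_description _ (Hex n)))).
assert (Has : forall n, Cmod (a n - z0) < / (INR n + 1) /\ Cmod (a n - z0) < delta / 2 /\
  0 < s n /\ forall w : C, Cmod (w - a n) <= s n -> O w).
{ intro n. exact (proj2_sig (constructive_indefinite_description _ (Hex n))). }
clearbody a s. clear Hex.
assert (Hd : forall n, 0 < Cmod (a n - z0)).
{ intro n. destruct (Has n) as [_ [_ [Hs Hin]]].
  generalize (disk_radius_le O z0 (a n) (s n) Hz0 Hin); lra. }
(* [j] codes a pair [(n, m)]; the [j]-th set says that [m] fails to bound the weighted coefficients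
   at [a n]. *)
exists (fun j f => exists k, INR (snd (of_nat j)) <
  Cmod (coef f (a (fst (of_nat j))) (s (fst (of_nat j))) k) *
  (3 * Cmod (a (fst (of_nat j)) - z0)) ^ k).
split.
- intro j. destruct (of_nat j) as [n m]; simpl. destruct (Has n) as [_ [_ [Hs Hin]]].
  apply H_open_coef; trivial. generalize (Hd n); lra.
- intros f Hf. split.
  + intros [_ Hnot] j. destruct (of_nat j) as [n m]; simpl.
    destruct (Has n) as [_ [Hdel [Hs Hin]]].
    apply NNPP; intro Hno. apply Hnot.
    apply (extends_of_coef_bound O z0 (a n) (s n) (INR m)); trivial.
    * apply Hconn; generalize (Hd n); lra.
    * intro k. apply Rnot_lt_le. intro Hk. apply Hno. exists k; exact Hk.
  + intros HP. split; [exact Hf|]. intros [r [F [Hr [HF E]]]].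
    (* For an extension to [disk z0 r], one centre [a n] with [4 * Cmod (a n - z0) < r] is enough;
       the real bound obtained there is then exceeded by an integer [m]. *)
    destruct (archimed_cor1 (r / 4)) as [n [Hn Hn']]; [lra|].
    destruct (Has n) as [Hdn [_ [Hs Hin]]].
    assert (Hlt : 4 * Cmod (a n - z0) < r).
    { assert (/ (INR n + 1) < / INR n); [|lra].
      apply lt_0_INR in Hn'. apply Rinv_lt_contravar; [apply Rmult_lt_0_compat|]; lra. }
    destruct (coef_bound_of_extends O z0 (a n) (s n) r f F) as [M HM]; trivial.
    destruct (INR_unbounded M) as [m Hm].
    destruct (HP (to_nat (n, m))) as [k Hk]. rewrite cancel_of_to in Hk; simpl in Hk.
    specialize (HM k). lra.
Qed.

(** The difference of the two extensions is bounded near [z0], yet on [O], which accumulates at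
    [z0], it equals [c / (w - z0)]. *)
Lemma not_extends_pole O (z0 c : C) f : boundary_point O z0 -> c <> 0%C ->
  extends_at O z0 f -> ~ extends_at O z0 (fun w => f w + c * / (w - z0))%C.
Proof.
intros [Hz0 Hbd] Hc [r1 [F [Hr1 [HF EF]]]] [r2 [G [Hr2 [HG EG]]]].
assert (Hz : forall r, 0 < r -> disk z0 r z0).
{ intros r Hr. change (Cmod (z0 - z0) < r). replace (z0 - z0)%C with (RtoC 0) by ring.
  rewrite Cmod_0; exact Hr. }
assert (CF := cdiff_of_holomorphic _ F z0 (is_open_disk z0 r1) HF (Hz r1 Hr1)).
assert (CG := cdiff_of_holomorphic _ G z0 (is_open_disk z0 r2) HG (Hz r2 Hr2)).
destruct (cdiff_continuous F z0 CF 1 Rlt_0_1) as [d1 [Hd1 B1]].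
destruct (cdiff_continuous G z0 CG 1 Rlt_0_1) as [d2 [Hd2 B2]].
(* Bounds [G w - F w] near [z0], each function varying by less than 1; [Cmod (w - z0) < Cmod c / B]
   contradicts it. *)
set (B := Cmod (G z0 - F z0) + 2).
assert (HB : 0 < B) by (unfold B; generalize (Cmod_ge_0 (G z0 - F z0)); lra).
assert (Hcm : 0 < Cmod c) by (apply Cmod_gt_0, Hc).
destruct (Hbd (Rmin (Rmin (Rmin r1 r2) (Rmin d1 d2)) (Cmod c / B))) as [w [Hw HwO]].
{ repeat apply Rmin_glb_lt; trivial. apply Rdiv_lt_0_compat; assumption. }
change (Cmod (w - z0) < Rmin (Rmin (Rmin r1 r2) (Rmin d1 d2)) (Cmod c / B)) in Hw.
apply Rmin_Rgt in Hw as [Hw HwB]. apply Rmin_Rgt in Hw as [Hwr Hwd].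
apply Rmin_Rgt in Hwr as [Hwr1 Hwr2]. apply Rmin_Rgt in Hwd as [Hwd1 Hwd2].
apply Rgt_lt in HwB, Hwr1, Hwr2, Hwd1, Hwd2.
specialize (EF w HwO Hwr1). specialize (EG w HwO Hwr2). cbv beta in EG.
specialize (B1 w Hwd1). specialize (B2 w Hwd2).
assert (E : (c * / (w - z0))%C = ((G z0 - F z0) + (G w - G z0) + - (F w - F z0))%C).
{ rewrite EF, EG. ring. }
assert (Hbound : Cmod (c * / (w - z0)) < B).
{ rewrite E. eapply Rle_lt_trans; [apply Cmod_triangle|]. rewrite Cmod_opp.
  eapply Rle_lt_trans; [apply Rplus_le_compat_r, Cmod_triangle|]. unfold B; lra. }
destruct (Req_dec (Cmod (w - z0)) 0) as [H0|H0].
- apply Cmod_eq_0, Cminus_eq_0 in H0. subst w. contradiction.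
- assert (Hpos : 0 < Cmod (w - z0)) by (generalize (Cmod_ge_0 (w - z0)); lra).
  rewrite Cmod_mult, Cmod_inv in Hbound by (apply Cmod_gt_0, Hpos).
  apply (Rmult_lt_compat_r (Cmod (w - z0))) in Hbound; [|exact Hpos].
  rewrite Rmult_assoc, Rinv_l, Rmult_1_r in Hbound by exact H0.
  apply Rlt_div_r in HwB; lra.
Qed.

Lemma H_dense_U1 O z0 : is_open O -> boundary_point O z0 -> H_dense O (U1 O z0).
Proof.
intros HO Hbd P HP [f [Hf HPf]].
destruct (classic (extends_at O z0 f)) as [Hext|Hno]; [|exists f; split; [|split; [|split]]; assumption].
destruct (HP f Hf HPf) as [K [eps [HK [HKO [He HPg]]]]].
destruct (compact_distance K z0 HK) as [m [Hm HmK]]; [intro H; apply (proj1 Hbd), HKO, H|].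
(* On [K], where [Cmod (z - z0) >= m], the added pole has modulus at most [eps / 2]. *)
set (c := RtoC (eps * m / 2)).
assert (Hc : 0 < eps * m / 2) by (apply Rdiv_lt_0_compat; nra).
assert (Hg : holomorphic_on O (fun w => f w + c * / (w - z0))%C).
{ apply holomorphic_of_cdiff. intros z Hz. apply cdiff_plus.
  - apply (cdiff_of_holomorphic O); assumption.
  - apply (cdiff_quotient (fun _ => c)); [apply cdiff_const|].
    intros ->. exact (proj1 Hbd Hz). }
exists (fun w => f w + c * / (w - z0))%C. split; [exact Hg|]. split.
- apply HPg; [exact Hg|]. intros z Hz. specialize (HmK z Hz).
  change (Cmod (f z + c * / (z - z0) - f z) < eps).
  replace (f z + c * / (z - z0) - f z)%C with (c * / (z - z0))%C by ring.
  rewrite Cmod_mult, Cmod_inv by (apply Cmod_gt_0; lra).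
  unfold c. rewrite Cmod_RtoC_pos by lra.
  apply Rle_lt_trans with (eps * m / 2 * / m).
  + apply Rmult_le_compat_l; [lra|]. apply Rinv_le_contravar; lra.
  + replace (eps * m / 2 * / m) with (eps / 2) by (field; lra). lra.
- split; [exact Hg|]. apply not_extends_pole; trivial. apply RtoC_pos_neq_0, Hc.
Qed.

Theorem theorem3p5 (O : Cplx -> Prop) (z0 : Cplx) :
  domain O ->
  (exists w, ~ O w) ->
  boundary_point O z0 ->
  (exists delta, 0 < delta /\
     forall r, 0 < r -> r <= delta -> open_connected (fun z => disk z0 r z /\ O z)) ->
  H_Gdelta O (U1 O z0) /\ H_dense O (U1 O z0).
Proof.
intros [HO _] _ Hbd [delta [Hdelta Hconn]]. split.
- exact (H_Gdelta_U1 O z0 delta HO Hbd Hdelta Hconn).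
- exact (H_dense_U1 O z0 HO Hbd).
Qed.
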